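(* Let $(S,L)$ be a Lie--Rinehart algebra over a field $\Bbbk$ with $L$ projective as an $S$-module, let $U$ be its universal enveloping algebra and let $M$ be a $U^e$-module. The $S$- and $L$-module structures on $H^\bullet(S,M)$ obtained from $U^e$-injective resolutions of $M$ (structure (I) in the context) are equal to those obtained from $S^e$-projective resolutions of $S$ (structure (P) in the context).
   Context: A Lie--Rinehart algebra $(S,L)$ over $\Bbbk$ consists of a commutative $\Bbbk$-algebra $S$, a Lie algebra $L$ over $\Bbbk$, a morphism of Lie algebras $L\to\mathrm{Der}_\Bbbk(S)$, $\alpha\mapsto\alpha_S$, and a left $S$-module structure on $L$ such that $(s\alpha)_S(t)=s\alpha_S(t)$ and $[\alpha,s\beta]=s[\alpha,\beta]+\alpha_S(s)\beta$. Its universal enveloping algebra $U$ is the associative algebra with an algebra morphism $i:S\to U$ and a Lie algebra morphism $j:L\to U$ satisfying $i(s)j(\alpha)=j(s\alpha)$ and $j(\alpha)i(s)-i(s)j(\alpha)=i(\alpha_S(s))$, universal with these properties. For an algebra $A$, $A^e=A\otimes A$ with product $(a_1\otimes a_2)(b_1\otimes b_2)=a_1b_1\otimes b_2a_2$; $A^e$-modules are $A$-bimodules, $(a\otimes b)\cdot m=amb$. $H^\bullet(S,M)=\mathrm{Ext}_{S^e}^\bullet(S,M)$, where $M$ is an $S^e$-module through $S\to U$. Structure (I). For every $U^e$-module $I$, $\mathrm{Hom}_{S^e}(S,I)$ is a left $U$-module with $(t\cdot\varphi)(s)=(t\otimes1)\cdot\varphi(s)$ and $(\alpha\cdot\varphi)(s)=(\alpha\otimes1)\cdot\varphi(s)-(1\otimes\alpha)\cdot\varphi(s)-\varphi(\alpha_S(s))$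 for $\alpha\in L$, $s,t\in S$. If $M\to I^\bullet$ is a $U^e$-injective resolution, the cohomology of the complex $\mathrm{Hom}_{S^e}(S,I^\bullet)$ is $H^\bullet(S,M)$, which inherits these actions of $S$ and $L$. Structure (P). Let $\varepsilon:P_\bullet\to S$ be an $S^e$-projective resolution, so $H^\bullet(S,M)$ is the cohomology of $\mathrm{Hom}_{S^e}(P_\bullet,M)$. The $S$-action is induced by $(s\cdot\phi)(p)=s\phi(p)$ for $\phi\in\mathrm{Hom}_{S^e}(P_i,M)$. For $\alpha\in L$, let $\alpha_\bullet=(\alpha_q:P_q\to P_q)_{q\ge0}$ be an $\alpha_S^e$-lifting of $\alpha_S$ (which always exists), i.e. a morphism of complexes of vector spaces with $\varepsilon\circ\alpha_0=\alpha_S\circ\varepsilon$ and $\alpha_q((s\otimes t)\cdot p)=(\alpha_S(s)\otimes t+s\otimes\alpha_S(t))\cdot p+(s\otimes t)\cdot\alpha_q(p)$. Put $\alpha_q^\sharp(\phi)=(\alpha\otimes1-1\otimes\alpha)\circ\phi-\phi\circ\alpha_q$ for $\phi\in\mathrm{Hom}_{S^e}(P_q,M)$, where $\alpha\otimes1-1\otimes\alpha$ denotes the map $M\to M$, $m\mapsto(\alpha\otimes1-1\otimes\alpha)\cdot m$. Then $\alpha$ acts on $H^q(S,M)$ by $\nabla_\alpha^q([\phi])=[\alpha_q^\sharp(\phi)]$. *)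

(* Defs.v *)
From HB Require Import structures.
From mathcomp Require Import all_boot all_algebra.
From mathcomp Require Import boolp classical_sets functions.

Set Implicit Arguments.
Unset Strict Implicit.
Unset Printing Implicit Defensive.

Import GRing.Theory.
Local Open Scope ring_scope.
Local Open Scope quotient_scope.

Reserved Notation "a ⊳ m" (at level 40, left associativity).
Reserved Notation "m ⊲ a" (at level 40, left associativity).

(* A^e-modules are represented by k-central A-bimodules, with
   (a ⊗ b) · m = a ⊳ m ⊲ b.  Both actions take the scalar first: m ⊲ a is
   ract a m. *)

Record bimod (k : fieldType) (A : algType k) := Bimod {
  bimod_sort :> lmodType k;
  lact : A -> bimod_sort -> bimod_sort;
  ract : A -> bimod_sort -> bimod_sort;
  lact_linearl : forall m, linear (lact ^~ m);
  lact_linearr : forall a, linear (lact a);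
  ract_linearl : forall m, linear (ract ^~ m);
  ract_linearr : forall a, linear (ract a);
  lact1 : forall m, lact 1 m = m;
  ract1 : forall m, ract 1 m = m;
  lactM : forall a b m, lact (a * b) m = lact a (lact b m);
  ractM : forall a b m, ract (a * b) m = ract b (ract a m);
  lractA : forall a m b, lact a (ract b m) = ract b (lact a m) }.

Notation "a ⊳ m" := (lact a m) : ring_scope.
Notation "m ⊲ a" := (ract a m) : ring_scope.

HB.instance Definition _ (k : fieldType) (A : algType k) (M : bimod A) (a : A) :=
  GRing.isLinear.Build k M M *:%R (@lact k A M a) (lact_linearr a).
HB.instance Definition _ (k : fieldType) (A : algType k) (M : bimod A) (a : A) :=
  GRing.isLinear.Build k M M *:%R (@ract k A M a) (ract_linearr a).

Section BimodTheory.
Variables (k : fieldType) (A : algType k) (M : bimod A).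
Implicit Types (a b : A) (m : M).

Lemma lactDl a b m : (a + b) ⊳ m = a ⊳ m + b ⊳ m.
Proof. by have := lact_linearl m 1 a b; rewrite /= !scale1r. Qed.
Lemma lact0l m : 0 ⊳ m = 0.
Proof. by apply: (addrI (0 ⊳ m)); rewrite -lactDl !addr0. Qed.
Lemma lactDr a m n : a ⊳ (m + n) = a ⊳ m + a ⊳ n. Proof. exact: raddfD. Qed.
Lemma lactBr a m n : a ⊳ (m - n) = a ⊳ m - a ⊳ n. Proof. exact: raddfB. Qed.
Lemma ractDr m a b : m ⊲ (a + b) = m ⊲ a + m ⊲ b.
Proof. by have := ract_linearl m 1 a b; rewrite /= !scale1r. Qed.
Lemma ract0r m : m ⊲ 0 = 0.
Proof. by apply: (addrI (m ⊲ 0)); rewrite -ractDr !addr0. Qed.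
Lemma ractDl m n a : (m + n) ⊲ a = m ⊲ a + n ⊲ a.
Proof. exact: raddfD. Qed.
Lemma ractBl m n a : (m - n) ⊲ a = m ⊲ a - n ⊲ a.
Proof. exact: raddfB. Qed.

End BimodTheory.

Section Regular.
Variables (k : fieldType) (A : algType k).

Let regl (m : A) : linear ( *%R^~ m : A -> A).
Proof. by move=> c x y; rewrite mulrDl scalerAl. Qed.
Let regr (m : A) : linear ( *%R m : A -> A).
Proof. by move=> c x y; rewrite mulrDr scalerAr. Qed.

Definition regbim : bimod A :=
  @Bimod k A A *%R (fun b m => m * b) regl regr regr regl
    (@mul1r A) (@mulr1 A) (fun a b m => esym (mulrA a b m))
    (fun a b m => mulrA m a b) (fun a m b => mulrA a m b).

End Regular.

Section Restriction.
Variables (k : fieldType) (A B : algType k) (f : {lrmorphism A -> B}).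
Variable M : bimod B.

Let resll (m : M) : linear (fun a => f a ⊳ m).
Proof. by move=> c x y; rewrite linearP; exact: lact_linearl. Qed.
Let resrr (m : M) : linear (fun a => m ⊲ f a).
Proof. by move=> c x y; rewrite linearP; exact: ract_linearl. Qed.
Let res1l (m : M) : f 1 ⊳ m = m. Proof. by rewrite rmorph1 lact1. Qed.
Let res1r (m : M) : m ⊲ f 1 = m. Proof. by rewrite rmorph1 ract1. Qed.
Let resMl a b (m : M) : f (a * b) ⊳ m = f a ⊳ (f b ⊳ m).
Proof. by rewrite rmorphM lactM. Qed.
Let resMr a b (m : M) : m ⊲ f (a * b) = m ⊲ f a ⊲ f b.
Proof. by rewrite rmorphM ractM. Qed.

Definition res : bimod A :=
  @Bimod k A M (fun a m => f a ⊳ m) (fun b m => m ⊲ f b)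
    resll (fun a => lact_linearr (f a)) resrr (fun a => ract_linearr (f a))
    res1l res1r resMl resMr (fun a m b => lractA (f a) m (f b)).

End Restriction.

Section Bihom.
Variables (k : fieldType) (A : algType k) (M N : bimod A).

Definition is_bihom (f : M -> N) : Prop :=
  [/\ linear f, forall a m, f (a ⊳ m) = a ⊳ f m
              & forall m a, f (m ⊲ a) = f m ⊲ a].

Definition bihom_pred : {pred M -> N} := fun f => `[< is_bihom f >].

Lemma bihom_predP f : reflect (is_bihom f) (f \in bihom_pred).
Proof. exact: asboolP. Qed.

Lemma bihom_pred_zmod : zmod_closed bihom_pred.
Proof.
split=> [|f g].
  apply/bihom_predP; split=> [c x y|a m|m a] /=; first by rewrite scaler0 addr0.
    exact: (esym (raddf0 (lact a))).
  exact: (esym (raddf0 (ract a))).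
move=> fP gP; have [f1 f2 f3] := bihom_predP f fP; have [g1 g2 g3] := bihom_predP g gP.
apply/bihom_predP.
split=> [c x y|a m|m a]; rewrite !fctE.
- by rewrite f1 g1 scalerBr opprD addrACA.
- by rewrite f2 g2 lactBr.
- by rewrite f3 g3 ractBl.
Qed.

HB.instance Definition _ := GRing.isZmodClosed.Build _ bihom_pred bihom_pred_zmod.

Record bihom := Bihom { bihom_fun :> M -> N; _ : bihom_fun \in bihom_pred }.

HB.instance Definition _ := [isSub for bihom_fun].
HB.instance Definition _ := [Choice of bihom by <:].
HB.instance Definition _ := [SubChoice_isSubZmodule of bihom by <:].

Definition mkbihom (f : M -> N) (fP : is_bihom f) : bihom :=
  Bihom (introT (bihom_predP f) fP).

Lemma bihomP (f : bihom) : is_bihom f.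
Proof. by case: f => f fP; apply/bihom_predP. Qed.

HB.instance Definition _ (f : bihom) :=
  GRing.isLinear.Build k M N *:%R f (let: And3 h _ _ := bihomP f in h).

Lemma bihom_lact (f : bihom) a m : f (a ⊳ m) = a ⊳ f m.
Proof. by case: (bihomP f). Qed.
Lemma bihom_ract (f : bihom) m a : f (m ⊲ a) = f m ⊲ a.
Proof. by case: (bihomP f). Qed.
Lemma bihom_ext (f g : bihom) : f =1 g -> f = g.
Proof. by move=> fg; apply: val_inj; apply/funext. Qed.
Lemma bihomBE (f g : bihom) m : (f - g) m = f m - g m. Proof. by []. Qed.

End Bihom.

Section BihomComp.
Variables (k : fieldType) (A : algType k) (M N Q : bimod A).

Lemma bihom_comp_subproof (g : bihom N Q) (f : bihom M N) : is_bihom (g \o f).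
Proof.
split=> [c x y|a m|m a] /=; first by rewrite !linearP.
  by rewrite !bihom_lact.
by rewrite !bihom_ract.
Qed.

Definition bihom_comp g f : bihom M Q := mkbihom (bihom_comp_subproof g f).

Lemma bihom_compBl g h f : bihom_comp (g - h) f = bihom_comp g f - bihom_comp h f.
Proof. exact: bihom_ext. Qed.
Lemma bihom_compBr g f h : bihom_comp g (f - h) = bihom_comp g f - bihom_comp g h.
Proof. by apply: bihom_ext => x; exact: raddfB. Qed.

Lemma bihom_comp0l f : bihom_comp 0 f = 0.
Proof. exact: bihom_ext. Qed.
Lemma bihom_comp0r g : bihom_comp g 0 = 0.
Proof. by apply: bihom_ext => x; exact: raddf0. Qed.

End BihomComp.

Definition bihom_res (k : fieldType) (A B : algType k) (i : {lrmorphism A -> B})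
    (M N : bimod B) (f : bihom M N) : bihom (res i M) (res i N) :=
  @mkbihom k A (res i M) (res i N) f
    (And3 (let: And3 h _ _ := bihomP f in h)
          (fun a m => bihom_lact f (i a) m) (fun m a => bihom_ract f m (i a))).

Definition projective_lmod (R : pzRingType) (L : lmodType R) : Prop :=
  forall (N Q : lmodType R) (p : {linear N -> Q}) (g : {linear L -> Q}),
    (forall y, exists x, p x = y) ->
    exists h : {linear L -> N}, forall x, p (h x) = g x.

Section Resolutions.
Variables (k : fieldType) (A : algType k).

Definition projective_bimod (P : bimod A) : Prop :=
  forall (N Q : bimod A) (p : bihom N Q) (g : bihom P Q),
    (forall y, exists x, p x = y) ->
    exists h : bihom P N, forall x, p (h x) = g x.

Definition injective_bimod (I : bimod A) : Prop :=
  forall (N Q : bimod A) (e : bihom N Q) (g : bihom N I),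
    injective e ->
    exists h : bihom Q I, forall x, h (e x) = g x.

Record projective_resolution (M : bimod A) := ProjectiveResolution {
  pr_obj :> nat -> bimod A;
  pr_d : forall n, bihom (pr_obj n.+1) (pr_obj n);
  pr_aug : bihom (pr_obj 0) M;
  pr_projective : forall n, projective_bimod (pr_obj n);
  pr_aug_surj : forall m, exists x, pr_aug x = m;
  pr_exact0 : forall x, pr_aug x = 0 <-> exists y, pr_d 0 y = x;
  pr_exact : forall n x, pr_d n x = 0 <-> exists y, pr_d n.+1 y = x }.

Record injective_resolution (M : bimod A) := InjectiveResolution {
  ir_obj :> nat -> bimod A;
  ir_d : forall n, bihom (ir_obj n) (ir_obj n.+1);
  ir_coaug : bihom M (ir_obj 0);
  ir_injective : forall n, injective_bimod (ir_obj n);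
  ir_coaug_inj : injective ir_coaug;
  ir_exact0 : forall x, ir_d 0 x = 0 <-> exists y, ir_coaug y = x;
  ir_exact : forall n x, ir_d n.+1 x = 0 <-> exists y, ir_d n y = x }.

End Resolutions.

Section ResolutionTheory.
Variables (k : fieldType) (A : algType k) (M : bimod A).

Lemma pr_dd (P : projective_resolution M) n x : pr_d P n (pr_d P n.+1 x) = 0.
Proof. by apply/pr_exact; exists x. Qed.
Lemma pr_aug_d (P : projective_resolution M) x : pr_aug P (pr_d P 0 x) = 0.
Proof. by apply/pr_exact0; exists x. Qed.
Lemma ir_dd (I : injective_resolution M) n x : ir_d I n.+1 (ir_d I n x) = 0.
Proof. by apply/ir_exact; exists x. Qed.
Lemma ir_d_coaug (I : injective_resolution M) x : ir_d I 0 (ir_coaug I x) = 0.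
Proof. by apply/ir_exact0; exists x. Qed.

End ResolutionTheory.

Record cochain := Cochain {
  cochain_obj :> nat -> zmodType;
  dif : forall n, cochain_obj n -> cochain_obj n.+1;
  dif_additive : forall n, zmod_morphism (@dif n);
  dif_dif : forall n (x : cochain_obj n), dif (dif x) = 0 }.

HB.instance Definition _ (C : cochain) n :=
  GRing.isZmodMorphism.Build _ _ (@dif C n) (@dif_additive C n).

Record cochain_map (C D : cochain) := CochainMap {
  cmap :> forall n, C n -> D n;
  cmap_additive : forall n, zmod_morphism (@cmap n);
  cmap_dif : forall n (x : C n), cmap (dif x) = dif (cmap x) }.
Arguments CochainMap {C D} cmap.
Arguments cmap {C D} c n x.

HB.instance Definition _ (C D : cochain) (f : cochain_map C D) n :=
  GRing.isZmodMorphism.Build _ _ (f n) (@cmap_additive C D f n).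

Section Cohomology.
Variables (C : cochain) (n : nat).

Definition cocycle_pred : {pred C n} := fun x => dif x == 0.

Lemma cocycle_pred_zmod : zmod_closed cocycle_pred.
Proof.
split=> [|x y]; rewrite !unfold_in; first by rewrite raddf0.
by move=> /eqP dx /eqP dy; rewrite raddfB /= dx dy subr0.
Qed.

HB.instance Definition _ := GRing.isZmodClosed.Build _ cocycle_pred cocycle_pred_zmod.

Record cocycle := Cocycle { cocycle_val :> C n; _ : cocycle_val \in cocycle_pred }.

HB.instance Definition _ := [isSub for cocycle_val].
HB.instance Definition _ := [Choice of cocycle by <:].
HB.instance Definition _ := [SubChoice_isSubZmodule of cocycle by <:].

Definition is_coboundary : C n -> Prop :=
  match n return C n -> Prop with
  | 0 => fun x => x = 0
  | m.+1 => fun x => exists y : C m, dif y = x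
  end.

Definition coboundary_pred : {pred cocycle} := fun z => `[< is_coboundary (val z) >].

Lemma coboundary_predP z : reflect (is_coboundary (val z)) (z \in coboundary_pred).
Proof. exact: asboolP. Qed.

Lemma is_coboundary0 : is_coboundary 0.
Proof. by rewrite /is_coboundary; case: n => [//|m]; exists 0; rewrite raddf0. Qed.

Lemma is_coboundaryB x y :
  is_coboundary x -> is_coboundary y -> is_coboundary (x - y).
Proof.
rewrite /is_coboundary; case: n x y => [x y -> ->|m x y [u <-] [v <-]].
  by rewrite subrr.
by exists (u - v); rewrite raddfB.
Qed.

Lemma coboundary_pred_zmod : zmod_closed coboundary_pred.
Proof.
split=> [|x y]; first by apply/coboundary_predP; exact: is_coboundary0.
by move=> /coboundary_predP hx /coboundary_predP hy; apply/coboundary_predP; exact: is_coboundaryB.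
Qed.

HB.instance Definition _ :=
  GRing.isZmodClosed.Build _ coboundary_pred coboundary_pred_zmod.

Definition cohomology : zmodType := Quotient.quot coboundary_pred.

Definition coclass (z : cocycle) : cohomology := \pi_(Quotient.quot coboundary_pred) z.

Lemma coclass_eq (z w : cocycle) :
  coclass z = coclass w <-> is_coboundary (val z - val w).
Proof.
split=> [/eqP|h]; first by rewrite /coclass piE => /asboolP.
by apply/eqP; rewrite /coclass piE; apply/asboolP.
Qed.

Lemma coclass_surj (x : cohomology) : exists z, coclass z = x.
Proof. by exists (repr x); rewrite /coclass reprK. Qed.

End Cohomology.

Section CohomologyMap.
Variables (C D : cochain) (f : cochain_map C D) (n : nat).

Lemma cocycle_map_subproof (z : cocycle C n) : f n (val z) \in @cocycle_pred D n.
Proof.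
by case: z => z /= /eqP dz; apply/eqP; rewrite -cmap_dif dz raddf0.
Qed.

Definition cocycle_map (z : cocycle C n) : cocycle D n :=
  Cocycle (cocycle_map_subproof z).

(* H^n(f); cohomology_mapE shows that it is [z] |-> [f z]. *)
Definition cohomology_map (x : cohomology C n) : cohomology D n :=
  coclass (cocycle_map (repr x)).

Lemma cohomology_mapE z : cohomology_map (coclass z) = coclass (cocycle_map z).
Proof.
apply/coclass_eq => /=; rewrite -raddfB.
have : is_coboundary (val (repr (coclass z)) - val z).
  by apply/coclass_eq; rewrite /coclass reprK.
move: (_ - _); rewrite /is_coboundary.
case: n f => [g x ->|m g x [y <-]]; first by rewrite raddf0.
by exists (g m y); exact: esym (cmap_dif g y).
Qed.

End CohomologyMap.

(* The k-module structure of L is the one induced by k -> S, c |-> c%:A. *)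
Record lie_rinehart (k : fieldType) (S : comAlgType k) (L : lmodType S) :=
  LieRinehart {
  lrbr : L -> L -> L;
  lranchor : L -> S -> S;
  lrbr_linearl : forall (c : k) a b x,
    lrbr (c%:A *: a + b) x = c%:A *: lrbr a x + lrbr b x;
  lrbr_linearr : forall (c : k) x a b,
    lrbr x (c%:A *: a + b) = c%:A *: lrbr x a + lrbr x b;
  lrbr_alt : forall a, lrbr a a = 0;
  lrbr_jacobi : forall a b c,
    lrbr a (lrbr b c) + lrbr b (lrbr c a) + lrbr c (lrbr a b) = 0;
  lranchor_linear : forall a, linear (lranchor a);
  lranchor_leibniz : forall a s t,
    lranchor a (s * t) = lranchor a s * t + s * lranchor a t;
  lranchorP : forall (c : k) a b s,
    lranchor (c%:A *: a + b) s = c *: lranchor a s + lranchor b s;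
  lranchor_br : forall a b s,
    lranchor (lrbr a b) s = lranchor a (lranchor b s) - lranchor b (lranchor a s);
  lranchorZ : forall s a t, lranchor (s *: a) t = s * lranchor a t;
  lrbrZ : forall a s b, lrbr a (s *: b) = s *: lrbr a b + lranchor a s *: b }.

Section Envelope.
Variables (k : fieldType) (S : comAlgType k) (L : lmodType S).
Variable LR : lie_rinehart L.

Definition enveloping_pair (A : algType k) (i : {lrmorphism S -> A}) (j : L -> A) : Prop :=
  [/\ forall (c : k) a b, j (c%:A *: a + b) = c *: j a + j b,
      forall a b, j (lrbr LR a b) = j a * j b - j b * j a,
      forall s a, i s * j a = j (s *: a)
    & forall a s, j a * i s - i s * j a = i (lranchor LR a s)].

Record envelope := Envelope {
  env_alg :> algType k;
  env_i : {lrmorphism S -> env_alg};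
  env_j : L -> env_alg;
  env_pair : enveloping_pair env_i env_j;
  env_univ : forall (A : algType k) (f : {lrmorphism S -> A}) (g : L -> A),
    enveloping_pair f g ->
    exists h : {lrmorphism env_alg -> A},
      [/\ forall s, h (env_i s) = f s, forall a, h (env_j a) = g a
        & forall h' : {lrmorphism env_alg -> A},
            (forall s, h' (env_i s) = f s) -> (forall a, h' (env_j a) = g a) ->
            h' =1 h] }.

End Envelope.


HB.instance Definition _ (k : fieldType) (S : comAlgType k) (L : lmodType S)
    (LR : lie_rinehart L) (a : L) :=
  GRing.isLinear.Build k S S *:%R (lranchor LR a) (lranchor_linear LR a).

Lemma lranchor1 (k : fieldType) (S : comAlgType k) (L : lmodType S)
  (LR : lie_rinehart L) a : lranchor LR a 1 = 0.
Proof.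
have := lranchor_leibniz LR a 1 1; rewrite !mulr1 mul1r => /eqP.
by rewrite -[X in X == _]addr0 (inj_eq (addrI _)) eq_sym => /eqP.
Qed.

(* The family whose n-th component is x and whose other components are 0. *)
Definition single (T : nat -> zmodType) (n : nat) (x : T n) (r : nat) : T r :=
  if @eqP _ n r is ReflectT e then ecast m (T m) e x else 0.

Lemma single_eq (T : nat -> zmodType) n (x : T n) : single x n = x.
Proof. by rewrite /single; case: eqP => // e; rewrite eq_axiomK. Qed.
Lemma single_neq (T : nat -> zmodType) n (x : T n) r : n != r -> single x r = 0.
Proof. by rewrite /single; case: eqP. Qed.
Lemma singleB (T : nat -> zmodType) n (x y : T n) r :
  single (x - y) r = single x r - single y r.
Proof. by rewrite /single; case: eqP => [e|_]; [case: r / e | rewrite subr0]. Qed.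

Section Operations.
Variables (k : fieldType) (S : comAlgType k) (L : lmodType S).
Variables (LR : lie_rinehart L) (U : envelope LR).

Local Notation i := (env_i U).
Local Notation j := (env_j U).
Local Notation anc := (lranchor LR).

Lemma env_ji a s : j a * i s = i s * j a + i (anc a s).
Proof. by case: (env_pair U) => _ _ _ <-; rewrite addrC subrK. Qed.

(* D is k-linear and compatible with the derivation of S^e induced by the action
   of a on S, (s ⊗ t) being the operator p |-> s ⊳ p ⊲ t. *)
Definition anchor_lift (a : L) (N : bimod S) (D : N -> N) : Prop :=
  linear D /\
  forall s t p, D (s ⊳ p ⊲ t) =
    (anc a s ⊳ p ⊲ t + s ⊳ p ⊲ anc a t) + s ⊳ D p ⊲ t.

Lemma anchor_liftl a N D : @anchor_lift a N D ->
  forall s p, D (s ⊳ p) = anc a s ⊳ p + s ⊳ D p.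
Proof.
by case=> _ h s p; have := h s 1 p; rewrite !ract1 lranchor1 ract0r addr0.
Qed.

Lemma anchor_liftr a N D : @anchor_lift a N D ->
  forall p t, D (p ⊲ t) = p ⊲ anc a t + D p ⊲ t.
Proof.
by case=> _ h p t; have := h 1 t p; rewrite !lact1 lranchor1 lact0l raddf0 add0r.
Qed.

Lemma anchor_lift_anchor a : @anchor_lift a (regbim S) (anc a).
Proof.
split=> [|s t p]; first exact: lranchor_linear.
by rewrite /= !lranchor_leibniz mulrDl -!addrA; congr (_ + _); rewrite addrC.
Qed.

Variables (N : bimod S) (Q : bimod U).
Implicit Type f : bihom N (res i Q).

Lemma hom_scale_subproof (t : S) f :
  @is_bihom _ _ N (res i Q) (fun p => i t ⊳ (f p : Q)).
Proof.
split=> [c x y|a m|m a]; first by rewrite !linearP.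
  by rewrite bihom_lact /= -!lactM -!rmorphM mulrC.
by rewrite bihom_ract /= lractA.
Qed.

Definition hom_scale (t : S) f : bihom N (res i Q) := mkbihom (hom_scale_subproof t f).

Lemma hom_lie_subproof (a : L) (D : N -> N) (DP : anchor_lift a D) f :
  @is_bihom _ _ N (res i Q)
    (fun p => j a ⊳ (f p : Q) - (f p : Q) ⊲ j a - f (D p)).
Proof.
have fl s p : f (s ⊳ p) = i s ⊳ (f p : Q) :> Q by exact: (bihom_lact f s p).
have fr s p : f (p ⊲ s) = (f p : Q) ⊲ i s :> Q by exact: (bihom_ract f p s).
split=> [c x y|s p|p s].
- by rewrite (proj1 DP) !linearP /= !scalerDr (addrACA (c *: _)) [LHS]addrACA.
- rewrite /= (anchor_liftl DP) raddfD /= !fl !lactBr -!lactM env_ji lactDl lractA.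
  by rewrite opprD addrA; congr (_ - _); rewrite addrAC addrK.
rewrite /= (anchor_liftr DP) raddfD /= !fr !ractBl lractA -!ractM env_ji ractDr.
by rewrite !opprD !addrA; congr (_ - _).
Qed.

(* For N = S and D = lranchor LR a this is the action of a on Hom_{S^e}(S, Q); for
   N = P_n and D the degree n part of a lifting of a it is the operator D^#. *)
Definition hom_lie a D (DP : anchor_lift a D) f : bihom N (res i Q) :=
  mkbihom (hom_lie_subproof DP f).


Lemma hom_scale_additive t : zmod_morphism (hom_scale t).
Proof. by move=> f g; apply: bihom_ext => p; exact: (lactBr (i t) (f p : Q) (g p)). Qed.

Lemma hom_lie_additive a D (DP : anchor_lift a D) : zmod_morphism (hom_lie DP).
Proof.
have sub3 (x x' y y' z z' : Q) :
    x - x' - (y - y') - (z - z') = x - y - z - (x' - y' - z').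
  by rewrite !opprD !opprK (addrACA x (- x')) [LHS]addrACA.
move=> f g; apply: bihom_ext => p; rewrite [RHS]/= -[RHS]sub3.
by rewrite -lactBr -ractBl.
Qed.

End Operations.

Section Complexes.
Variables (k : fieldType) (S : comAlgType k) (L : lmodType S).
Variables (LR : lie_rinehart L) (U : envelope LR) (M : bimod U).
Variables (I : injective_resolution M) (P : projective_resolution (regbim S)).

Local Notation i := (env_i U).
Local Notation j := (env_j U).

Definition HomSI_d n (f : bihom (regbim S) (res i (I n))) :
  bihom (regbim S) (res i (I n.+1)) := bihom_comp (bihom_res i (ir_d I n)) f.

Lemma HomSI_d_additive n : zmod_morphism (@HomSI_d n).
Proof. by move=> f g; rewrite /HomSI_d bihom_compBr. Qed.

Lemma HomSI_dd n f : HomSI_d (@HomSI_d n f) = 0.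
Proof. by apply: bihom_ext => s /=; rewrite ir_dd. Qed.

Definition HomSI : cochain :=
  @Cochain (fun n => bihom (regbim S) (res i (I n))) HomSI_d HomSI_d_additive HomSI_dd.

Lemma HomSI_scale_dif (t : S) n (f : HomSI n) :
  hom_scale t (dif f : bihom _ _) = dif (hom_scale t f : HomSI n).
Proof. by apply: bihom_ext => s /=; rewrite bihom_lact. Qed.

Definition HomSI_scale (t : S) : cochain_map HomSI HomSI :=
  @CochainMap HomSI HomSI (fun n => hom_scale t)
    (fun n => hom_scale_additive t) (HomSI_scale_dif t).

Lemma HomSI_lie_dif (a : L) n (f : HomSI n) :
  hom_lie (anchor_lift_anchor LR a) (dif f : bihom _ _) =
  dif (hom_lie (anchor_lift_anchor LR a) f : HomSI n).
Proof. by apply: bihom_ext => s /=; rewrite !raddfB /= bihom_lact bihom_ract. Qed.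

Definition HomSI_lie (a : L) : cochain_map HomSI HomSI :=
  @CochainMap HomSI HomSI (fun n => hom_lie (anchor_lift_anchor LR a))
    (fun n => hom_lie_additive (anchor_lift_anchor LR a)) (HomSI_lie_dif a).

Definition HomPM_d n (f : bihom (P n) (res i M)) : bihom (P n.+1) (res i M) :=
  bihom_comp f (pr_d P n).

Lemma HomPM_d_additive n : zmod_morphism (@HomPM_d n).
Proof. by move=> f g; rewrite /HomPM_d bihom_compBl. Qed.

Lemma HomPM_dd n f : HomPM_d (@HomPM_d n f) = 0.
Proof. by apply: bihom_ext => s /=; rewrite pr_dd raddf0. Qed.

Definition HomPM : cochain :=
  @Cochain (fun n => bihom (P n) (res i M)) HomPM_d HomPM_d_additive HomPM_dd.

Lemma HomPM_scale_dif (t : S) n (f : HomPM n) :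
  hom_scale t (dif f : bihom _ _) = dif (hom_scale t f : HomPM n).
Proof. exact: bihom_ext. Qed.

Definition HomPM_scale (t : S) : cochain_map HomPM HomPM :=
  @CochainMap HomPM HomPM (fun n => hom_scale t)
    (fun n => hom_scale_additive t) (HomPM_scale_dif t).

Record lifting (a : L) := Lifting {
  lift_fun :> forall n, P n -> P n;
  lift_anchor : forall n, anchor_lift LR a (@lift_fun n);
  lift_aug : forall p, pr_aug P (lift_fun p) = lranchor LR a (pr_aug P p);
  lift_d : forall n p, pr_d P n (lift_fun p) = lift_fun (pr_d P n p) }.

Lemma HomPM_lie_dif (a : L) (D : lifting a) n (f : HomPM n) :
  hom_lie (lift_anchor D n.+1) (dif f : bihom _ _) =
  dif (hom_lie (lift_anchor D n) f : HomPM n).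
Proof. by apply: bihom_ext => p /=; rewrite lift_d. Qed.

Definition HomPM_lie (a : L) (D : lifting a) : cochain_map HomPM HomPM :=
  @CochainMap HomPM HomPM (fun n => hom_lie (lift_anchor D n))
    (fun n => hom_lie_additive (lift_anchor D n)) (HomPM_lie_dif D).

(* TotPI is the total complex of the double complex Hom_{S^e}(P_p, I^r), with
   differential (d h)_{p,r} = h_{p-1,r} o d_P + (-1)^p d_I o h_{p,r-1}.  To avoid
   casts, its degree n part is the group of families h indexed by all (p, r)
   with h p r = 0 unless p + r = n. *)

Definition bifam := forall p r, bihom (P p) (res i (I r)).

HB.instance Definition _ := Choice.on bifam.

Definition bifam_add (h g : bifam) : bifam := fun p r => h p r + g p r.
Definition bifam_opp (h : bifam) : bifam := fun p r => - h p r.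
Definition bifam_zero : bifam := fun p r => 0.

Lemma bifam_ext (h g : bifam) : (forall p r, h p r = g p r) -> h = g.
Proof. by move=> hg; apply: functional_extensionality_dep => p;
          apply: functional_extensionality_dep => r. Qed.
Lemma bifam_addA : associative bifam_add.
Proof. by move=> f g h; apply: bifam_ext => p r; exact: addrA. Qed.
Lemma bifam_addC : commutative bifam_add.
Proof. by move=> f g; apply: bifam_ext => p r; exact: addrC. Qed.
Lemma bifam_add0 : left_id bifam_zero bifam_add.
Proof. by move=> f; apply: bifam_ext => p r; exact: add0r. Qed.
Lemma bifam_addN : left_inverse bifam_zero bifam_opp bifam_add.
Proof. by move=> f; apply: bifam_ext => p r; exact: addNr. Qed.

HB.instance Definition _ :=
  GRing.isZmodule.Build bifam bifam_addA bifam_addC bifam_add0 bifam_addN.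

Lemma bifamNE (h : bifam) p r : (- h) p r = - h p r. Proof. by []. Qed.

Definition bifam_dP (h : bifam) : bifam := fun p r =>
  if p is p'.+1 then bihom_comp (h p' r) (pr_d P p') else 0.
Definition bifam_dI (h : bifam) : bifam := fun p r =>
  if r is r'.+1 then bihom_comp (bihom_res i (ir_d I r')) (h p r') else 0.

Definition bifam_d (h : bifam) : bifam := fun p r =>
  bifam_dP h p r + bifam_dI h p r *~ (-1) ^+ p.

Lemma bifam_dPdP h p r : bifam_dP (bifam_dP h) p r = 0.
Proof.
by case: p => [|[|p]] //=; apply: bihom_ext => x //=; rewrite pr_dd raddf0.
Qed.

Lemma bifam_dIdI h p r : bifam_dI (bifam_dI h) p r = 0.
Proof.
case: r => [|[|r]] //=; apply: bihom_ext => x /=; last by rewrite ir_dd.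
exact: (raddf0 (ir_d I 0)).
Qed.

Lemma bifam_dPdI h p r : bifam_dP (bifam_dI h) p r = bifam_dI (bifam_dP h) p r.
Proof.
case: p r => [|p] [|r] //=; apply: bihom_ext => x //=.
exact: esym (raddf0 (ir_d I r)).
Qed.

Lemma bifam_dP_additive : zmod_morphism bifam_dP.
Proof.
move=> h g; apply: bifam_ext => p r; rewrite [RHS]/GRing.add /=.
by case: p => [|p]; [exact: esym (subr0 _) | exact: bihom_compBl].
Qed.

Lemma bifam_dI_additive : zmod_morphism bifam_dI.
Proof.
move=> h g; apply: bifam_ext => p r.
by case: r => [|r]; [exact: esym (subr0 _) | exact: bihom_compBr].
Qed.

HB.instance Definition _ :=
  GRing.isZmodMorphism.Build bifam bifam bifam_dP bifam_dP_additive.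
HB.instance Definition _ :=
  GRing.isZmodMorphism.Build bifam bifam bifam_dI bifam_dI_additive.

Definition bifam_sgn (h : bifam) : bifam := fun p r => h p r *~ (-1) ^+ p.

Lemma bifam_sgn_additive : zmod_morphism bifam_sgn.
Proof. by move=> h g; apply: bifam_ext => p r; exact: mulrzBl. Qed.

HB.instance Definition _ :=
  GRing.isZmodMorphism.Build bifam bifam bifam_sgn bifam_sgn_additive.

Lemma bifam_dE h : bifam_d h = bifam_dP h + bifam_sgn (bifam_dI h).
Proof. by []. Qed.

Lemma bifam_d_additive : zmod_morphism bifam_d.
Proof. by move=> h g; rewrite !bifam_dE !raddfB /= opprD addrACA. Qed.

Lemma bifam_dI_sgn h : bifam_dI (bifam_sgn h) = bifam_sgn (bifam_dI h).
Proof.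
apply: bifam_ext => p [|r]; first by rewrite /bifam_sgn /= mul0rz.
rewrite /bifam_sgn /=; case: (odd p) (signr_odd int p) => <-.
  by rewrite expr1 !mulrNz !mulr1z; apply: bihom_ext => x; exact: raddfN.
by rewrite !mulr1z.
Qed.

Lemma bifam_dP_sgn h : bifam_dP (bifam_sgn h) = - bifam_sgn (bifam_dP h).
Proof.
apply: bifam_ext => [[|p] r].
  by rewrite bifamNE /bifam_sgn /= mul0rz oppr0.
rewrite bifamNE /bifam_sgn /= exprS mulN1r mulrNz opprK.
case: (odd p) (signr_odd int p) => <-; last by rewrite !mulr1z.
by rewrite expr1 !mulrNz !mulr1z; apply: bihom_ext.
Qed.

Lemma bifam_dd h : bifam_d (bifam_d h) = 0.
Proof.
rewrite !bifam_dE !raddfD /= bifam_dI_sgn bifam_dP_sgn.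
have -> : bifam_dP (bifam_dP h) = 0 by apply: bifam_ext => p r; exact: bifam_dPdP.
have -> : bifam_dI (bifam_dI h) = 0 by apply: bifam_ext => p r; exact: bifam_dIdI.
have -> : bifam_dP (bifam_dI h) = bifam_dI (bifam_dP h).
  by apply: bifam_ext => p r; exact: bifam_dPdI.
by rewrite !raddf0 add0r addr0 addNr.
Qed.

Definition tot_pred n : {pred bifam} :=
  fun h => `[< forall p r, (p + r)%N != n -> h p r = 0 >].

Lemma tot_predP n h :
  reflect (forall p r, (p + r)%N != n -> h p r = 0) (h \in tot_pred n).
Proof. exact: asboolP. Qed.

Lemma tot_pred_zmod n : zmod_closed (tot_pred n).
Proof.
split=> [|h g hP gP]; apply/tot_predP => // p r pr.
rewrite [LHS](_ : _ = h p r - g p r) //.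
by rewrite (tot_predP _ _ hP) // (tot_predP _ _ gP) // subrr.
Qed.

HB.instance Definition _ n := GRing.isZmodClosed.Build _ (tot_pred n) (tot_pred_zmod n).

Record tot n := Tot { tot_val : bifam; _ : tot_val \in tot_pred n }.

HB.instance Definition _ n := [isSub for @tot_val n].
HB.instance Definition _ n := [Choice of tot n by <:].
HB.instance Definition _ n := [SubChoice_isSubZmodule of tot n by <:].

Lemma tot_ext n (h g : tot n) : (forall p r, val h p r = val g p r) -> h = g.
Proof. by move=> hg; apply: val_inj; exact: bifam_ext. Qed.

Lemma tot_d_subproof n (h : tot n) : bifam_d (val h) \in tot_pred n.+1.
Proof.
case: h => h /= /tot_predP hP; apply/tot_predP => p r pr; rewrite /bifam_d.
have -> : bifam_dP h p r = 0.
  by case: p pr => [|p] //= pr; rewrite hP //; apply: bihom_ext.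
rewrite add0r; have -> : bifam_dI h p r = 0; last by rewrite mul0rz.
case: r pr => [|r] //=; rewrite addnS eqSS => pr; rewrite hP //.
by apply: bihom_ext => x; exact: (raddf0 (ir_d I r)).
Qed.

Definition tot_d n (h : tot n) : tot n.+1 := Tot (tot_d_subproof h).

Lemma tot_d_additive n : zmod_morphism (@tot_d n).
Proof. by move=> h g; apply: val_inj; exact: bifam_d_additive. Qed.

Lemma tot_dd n h : tot_d (@tot_d n h) = 0.
Proof. by apply: val_inj; exact: bifam_dd. Qed.

Definition TotPI : cochain := @Cochain tot tot_d tot_d_additive tot_dd.


(* toTotI is f |-> f o pr_aug P, in bidegree (0, n), and toTotP is
   phi |-> ir_coaug I o phi, in bidegree (n, 0).  Both are quasi-isomorphisms when
   L is S-projective, which identifies the two models of Ext_{S^e}(S, M). *)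

Lemma toTotI_subproof n (f : HomSI n) :
  (fun p r => single (T := fun p => bihom (P p) (res i (I r)))
     (bihom_comp (single (T := HomSI) f r) (pr_aug P)) p) \in tot_pred n.
Proof.
apply/tot_predP => p r pr.
case: (eqVneq 0 p) pr => [<-|p0] pr; last exact: single_neq.
rewrite single_eq (single_neq (T := HomSI)) 1?eq_sym //.
exact: bihom_ext.
Qed.

Definition toTotI_fun n (f : HomSI n) : TotPI n := Tot (toTotI_subproof f).

Lemma toTotI_additive n : zmod_morphism (@toTotI_fun n).
Proof.
move=> f g; apply: tot_ext => p r /=.
rewrite [RHS](_ : _ = val (toTotI_fun f) p r - val (toTotI_fun g) p r) //=.
by rewrite (singleB (T := HomSI)) bihom_compBl singleB.
Qed.

Lemma toTotI_dif n (f : HomSI n) : toTotI_fun (dif f) = dif (toTotI_fun f).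
Proof.
apply: tot_ext => p r /=; rewrite /bifam_d.
case: p => [|p].
  rewrite single_eq /= add0r mulr1z; case: r => [|r] /=.
    by rewrite (single_neq (T := HomSI)) // bihom_comp0l.
  rewrite single_eq; case: (eqVneq n r) => [<-|nr].
    by rewrite !(single_eq (T := HomSI)); apply: bihom_ext.
  by rewrite !(single_neq (T := HomSI)) // !bihom_comp0l bihom_comp0r.
rewrite single_neq //=; apply: esym; rewrite [X in _ + X *~ _](_ : _ = 0); last first.
  by case: r => [|r] //=; rewrite single_neq // bihom_comp0r.
rewrite mul0rz addr0; case: p => [|p]; last by rewrite single_neq // bihom_comp0l.
by rewrite single_eq; apply: bihom_ext => x /=; rewrite pr_aug_d raddf0.
Qed.

Definition toTotI : cochain_map HomSI TotPI :=
  @CochainMap HomSI TotPI toTotI_fun toTotI_additive toTotI_dif.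

Lemma toTotP_subproof n (f : HomPM n) :
  (fun p r => single (T := fun r => bihom (P p) (res i (I r)))
     (bihom_comp (bihom_res i (ir_coaug I)) (single (T := HomPM) f p)) r)
  \in tot_pred n.
Proof.
apply/tot_predP => p r pr.
case: (eqVneq 0 r) pr => [<-|r0] pr; last exact: single_neq.
rewrite single_eq (single_neq (T := HomPM)); last by rewrite eq_sym -[p]addn0.
by apply: bihom_ext => x; exact: (raddf0 (ir_coaug I)).
Qed.

Definition toTotP_fun n (f : HomPM n) : TotPI n := Tot (toTotP_subproof f).

Lemma toTotP_additive n : zmod_morphism (@toTotP_fun n).
Proof.
move=> f g; apply: tot_ext => p r /=.
rewrite [RHS](_ : _ = val (toTotP_fun f) p r - val (toTotP_fun g) p r) //=.
by rewrite (singleB (T := HomPM)) bihom_compBr singleB.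
Qed.

Lemma toTotP_dif n (f : HomPM n) : toTotP_fun (dif f) = dif (toTotP_fun f).
Proof.
apply: tot_ext => p r /=; rewrite /bifam_d.
case: r => [|r].
  rewrite single_eq /= mul0rz addr0; case: p => [|p] /=.
    by rewrite (single_neq (T := HomPM)) // bihom_comp0r.
  rewrite single_eq; case: (eqVneq n p) => [<-|np].
    by rewrite !(single_eq (T := HomPM)); apply: bihom_ext.
  by rewrite !(single_neq (T := HomPM)) // !bihom_comp0r bihom_comp0l.
rewrite single_neq //=; apply: esym; rewrite [X in X + _](_ : _ = 0); last first.
  by case: p => [|p] //=; rewrite single_neq // bihom_comp0l.
rewrite add0r; case: r => [|r]; last by rewrite single_neq // bihom_comp0r mul0rz.
rewrite single_eq; set X := bihom_comp _ _; suff -> : X = 0 by rewrite mul0rz.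
by apply: bihom_ext => x; exact: (ir_d_coaug I).
Qed.

Definition toTotP : cochain_map HomPM TotPI :=
  @CochainMap HomPM TotPI toTotP_fun toTotP_additive toTotP_dif.

End Complexes.

(* Main.v *)
(* Both structures are transported to the total complex of Hom_{S^e}(P_p, I^r), on which
   a in L acts by h |-> a h - h a - h o D_p for a lifting D of a; the two edge maps toTotI and
   toTotP commute strictly with this action, so it remains to see that they are
   quasi-isomorphisms. For toTotP this is the projectivity of the P_p. For toTotI one needs
   Ext^n_{S^e}(S, I) = 0 for n > 0 and every injective U^e-module I. Since k is a field, P -> S
   is contractible as a complex of left S-modules; if U is projective as a left S-module, then
   Hom_{S^e}(-, Hom_k(U, I)) is exact on sequences that split over S on the left, and I is a
   direct summand of Hom_k(U, I).
     Projectivity of U is a form of the Poincare-Birkhoff-Witt theorem. An Eilenberg swindle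
   makes L a retract of a Lie-Rinehart algebra L x F that is free over S; the latter is
   represented on the free S-module on words by straightening, and U is a direct summand of
   this representation. *)
Require Import Defs.
From HB Require Import structures.
From mathcomp Require Import all_boot all_algebra.
From mathcomp Require Import boolp classical_sets functions wochoice.
From mathcomp Require Import finmap.
From mathcomp.multinomials Require Import monalg.

Set Implicit Arguments.
Unset Strict Implicit.
Unset Printing Implicit Defensive.

Import GRing.Theory.
Local Open Scope ring_scope.

(** * Linear algebra: free modules, kernels, coinduced bimodules *)

(** Straightening needs a basis, while L is only projective. Adding a complement Q with L + Q free
    does not settle this: extending the bracket to L x Q as a semidirect product calls for a flat
    connection of L on Q, which a projective module need not carry. A free module does carry one,
    differentiation of coefficients by the anchor. So the added summand is a free F, and the swindle
    is what makes L x F free again. The operators on words obey a Leibniz rule and are not S-linear,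
    so relations between them cannot be tested on a basis directly. The failure of each relation is
    S-linear in every variable, because the derivation terms cancel; it is these [defect] maps that
    are reduced to words and basis elements. *)

Section ZmodMorphism.
Variables (V W : zmodType) (f : V -> W) (fB : zmod_morphism f).

Lemma zmod_morphism0 : f 0 = 0.
Proof. by have := fB 0 0; rewrite !subrr. Qed.
Lemma zmod_morphismN x : f (- x) = - f x.
Proof. by rewrite -[- x]sub0r fB zmod_morphism0 sub0r. Qed.
Lemma zmod_morphismD x y : f (x + y) = f x + f y.
Proof. by rewrite -{1}[y]opprK fB zmod_morphismN opprK. Qed.

End ZmodMorphism.

Section MalgExt.
Variables (K : choiceType) (G M : zmodType).

(** Coefficients enter through a function [F x], additive in all uses, instead of a scalar action:
    the operators on words differentiate coefficients and evaluation multiplies by [i s], neither of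
    which is an S-linear extension. *)
Definition malg_ext (F : K -> G -> M) (g : {malg G[K]}) : M :=
  \sum_(x <- msupp g) F x g@_x.

Lemma malg_ext_eq (f g : {malg G[K]} -> M) :
  zmod_morphism f -> zmod_morphism g ->
  (forall c x, f << c *g x >> = g << c *g x >>) -> f =1 g.
Proof.
move=> fB gB fg v; pose F := GRing.isZmodMorphism.Build _ _ f fB.
pose F' : {additive _ -> _} := HB.pack f F.
pose H := GRing.isZmodMorphism.Build _ _ g gB.
pose H' : {additive _ -> _} := HB.pack g H.
rewrite (monalgE v) -[f]/(F' : _ -> _) -[g]/(H' : _ -> _) !raddf_sum.
by apply: eq_bigr => x _; exact: fg.
Qed.

Variables (F : K -> G -> M) (F_additive : forall x, zmod_morphism (F x)).

Lemma malg_extEw (d : {fset K}) g : (msupp g `<=` d)%fset ->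
  malg_ext F g = \sum_(x <- d) F x g@_x.
Proof.
move=> gd; rewrite /malg_ext; apply: big_fset_incl => // x _ /mcoeff_outdom ->.
exact: zmod_morphism0.
Qed.

Lemma malg_ext_additive : zmod_morphism (malg_ext F).
Proof.
move=> g h; pose d := (msupp g `|` msupp h)%fset.
rewrite (@malg_extEw d g) ?fsubsetUl // (@malg_extEw d h) ?fsubsetUr //.
rewrite (@malg_extEw d) ?msuppB_le // -sumrB.
by apply: eq_bigr => x _; rewrite mcoeffB F_additive.
Qed.

Lemma malg_extU c x : malg_ext F << c *g x >> = F x c.
Proof.
by rewrite (@malg_extEw [fset x]%fset) ?msuppU_le // big_seq_fset1 mcoeffUU.
Qed.

End MalgExt.

Lemma malgZU (K : choiceType) (R : nzRingType) (c d : R) (x : K) :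
  c *: << d *g x >> = << c * d *g x >>.
Proof.
by apply/malgP => y; rewrite mcoeffZ !mcoeffU; case: eqVneq; rewrite ?mulr0.
Qed.

Lemma malg_ext_scale (K : choiceType) (R : nzRingType) (M : zmodType)
    (F F' : K -> R -> M) (c : R) g :
  (forall x, zmod_morphism (F x)) -> (forall x, zmod_morphism (F' x)) ->
  (forall x d, F x (c * d) = F' x d) -> malg_ext F (c *: g) = malg_ext F' g.
Proof.
move=> FB FB' FF'; move: g; have eB := malg_ext_additive FB.
apply: malg_ext_eq => [u v||d x]; first by rewrite scalerBr eB.
  exact: malg_ext_additive.
by rewrite malgZU !malg_extU.
Qed.

Lemma malg_extZ (K : choiceType) (R : nzRingType) (M : zmodType) (F : K -> R -> M)
    (h : M -> M) (c : R) g :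
  (forall x, zmod_morphism (F x)) -> zmod_morphism h ->
  (forall x d, F x (c * d) = h (F x d)) -> malg_ext F (c *: g) = h (malg_ext F g).
Proof.
move=> FB hB Fh; move: g; have eB := malg_ext_additive FB.
apply: malg_ext_eq => [u v|u v|d x]; first by rewrite scalerBr eB.
  by rewrite eB hB.
by rewrite malgZU !malg_extU.
Qed.

Section MalgLin.
Variables (K : choiceType) (R : nzRingType) (M : lmodType R).

Definition malg_lin (h : K -> M) : {malg R[K]} -> M :=
  malg_ext (fun x c => c *: h x).

Lemma malg_lin_additive h : zmod_morphism (malg_lin h).
Proof. by apply: malg_ext_additive => x a b; rewrite scalerBl. Qed.

Lemma malg_linU h c x : malg_lin h << c *g x >> = c *: h x.
Proof. by rewrite /malg_lin malg_extU // => y a b; rewrite scalerBl. Qed.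

Lemma malg_lin_linear h : linear (malg_lin h).
Proof.
have FB x : zmod_morphism (fun c : R => c *: h x) by move=> c d; rewrite scalerBl.
move=> c u v; rewrite (zmod_morphismD (malg_lin_additive h)); congr (_ + _).
by apply: (malg_extZ _ FB) => [x y|x d]; [exact: scalerBr | rewrite scalerA].
Qed.

HB.instance Definition _ h :=
  GRing.isLinear.Build R {malg R[K]} M *:%R (malg_lin h) (malg_lin_linear h).

Lemma malg_lin_eq (f g : {linear {malg R[K]} -> M}) :
  (forall x, f << x >> = g << x >>) -> f =1 g.
Proof.
move=> fg; apply: malg_ext_eq; [exact: raddfB | exact: raddfB |].
by move=> c x; rewrite -[c]mulr1 -malgZU !linearZ /= fg.
Qed.

End MalgLin.

Section Klin.
Variables (k : fieldType) (V W : lmodType k).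

Definition klin_pred : {pred V -> W} := fun f => `[< linear f >].

Lemma klin_pred_submod : submod_closed klin_pred.
Proof.
split=> [|c f g /asboolP fP /asboolP gP]; apply/asboolP => a x y /=.
  by rewrite scaler0 addr0.
by rewrite !fctE fP gP !scalerDr !scalerA (mulrC c) addrACA.
Qed.

HB.instance Definition _ := GRing.isSubmodClosed.Build k _ klin_pred klin_pred_submod.

Record klin := Klin { klin_fun :> V -> W; _ : klin_fun \in klin_pred }.

HB.instance Definition _ := [isSub for klin_fun].
HB.instance Definition _ := [Choice of klin by <:].
HB.instance Definition _ := [SubChoice_isSubZmodule of klin by <:].
HB.instance Definition _ := [SubZmodule_isSubLmodule of klin by <:].

Definition mkklin (f : V -> W) (fP : linear f) : klin := Klin (introT (asboolP _) fP).

Lemma klinP (f : klin) : linear f.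
Proof. by case: f => f fP; apply/asboolP. Qed.

HB.instance Definition _ (f : klin) := GRing.isLinear.Build k V W *:%R f (klinP f).

Lemma klin_ext (f g : klin) : f =1 g -> f = g.
Proof. by move=> fg; apply: val_inj; apply/funext. Qed.

End Klin.

Section LinearLift.
Variables (k : fieldType) (N Q : lmodType k) (e : N -> Q) (e_linear : linear e).
Local Open Scope classical_set_scope.

HB.instance Definition _ := GRing.isLinear.Build k N Q *:%R e e_linear.

Definition is_subspace (C : set N) : Prop :=
  C 0 /\ forall (c : k) x y, C x -> C y -> C (c *: x + y).

(** Zorn's lemma gives a subspace maximal among those meeting the kernel trivially. If it missed
    [e x], adding the line through [x] would keep the intersection trivial. *)
Lemma kernel_complement : exists C : set N,
  [/\ is_subspace C, forall x, C x -> e x = 0 -> x = 0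
    & forall x, exists2 y, C y & e y = e x].
Proof.
pose P (C : set N) := is_subspace C /\ forall x, C x -> e x = 0 -> x = 0.
pose P0 (C : set N) := C = set0 \/ P C.
have P00 : P [set 0] by split=> [|x ->//]; split=> // c x y -> ->; rewrite scaler0 addr0.
have chain F : F `<=` P0 -> total_on F subset -> P0 (\bigcup_(X in F) X).
  move=> FP Ft; have [F0|] := pselect (forall X, F X -> X = set0).
    left; apply/seteqP; split=> // x [X /F0 ->] //.
  move=> /existsNP[X /not_implyP[FX X0]]; right.
  have PX Y y : F Y -> Y y -> P Y by move=> /FP[->|//].
  have {}PX' : P X by have [] := FP X FX.
  split; last by move=> x [Y FY Yx]; case: (PX Y x FY Yx) => _; apply.
  split; first by exists X => //; case: PX' => -[].
  move=> c x y [Y FY Yx] [Z FZ Zy].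
  have [YZ|ZY] := Ft Y Z FY FZ.
    by exists Z => //; case: (PX Z y FZ Zy) => -[_ + _]; apply=> //; exact: YZ.
  by exists Y => //; case: (PX Y x FY Yx) => -[_ + _]; apply=> //; exact: ZY.
have [C [CP Cmax]] := Zorn_bigcup chain.
have {CP} [[C0 CD] Cker] : P C.
  case: CP => // C0; case: (Cmax [set 0]); last by right.
  by rewrite C0; split=> // /(_ 0 erefl).
exists C; split=> // x; apply: contrapT => xC.
pose D := [set z | exists c y, C y /\ z = c *: x + y].
have CsubD : C `<=` D by move=> y Cy; exists 0, y; rewrite scale0r add0r.
have Dx : D x by exists 1, 0; rewrite scale1r addr0.
apply: (Cmax D).
  by split=> // /(_ x Dx) Cx; apply: xC; exists x.
right; split.
  split; first exact: CsubD.
  move=> c _ _ [a [y [Cy ->]]] [b [z [Cz ->]]].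
  exists (c * a + b), (c *: y + z); split; first exact: CD.
  by rewrite scalerDr scalerDl scalerA addrACA.
move=> _ [c [y [Cy ->]]]; rewrite linearP /=.
have [->|c0] := eqVneq c 0; first by rewrite !scale0r !add0r; exact: Cker.
move=> exy; case: xC; exists (- c^-1 *: y).
  by have := CD (- c^-1) y 0 Cy C0; rewrite addr0.
rewrite linearZ /= scaleNr -[RHS](scalerK c0) -scalerN; congr (_ *: _).
by apply/eqP; rewrite eq_sym -addr_eq0 exy.
Qed.

(** Preimages chosen inside a complement of the kernel are unique, and uniqueness makes the choice
    linear. *)
Lemma linear_lift (V : lmodType k) (g : V -> Q) : linear g ->
  (forall v, exists x, e x = g v) ->
  exists2 h : V -> N, linear h & forall v, e (h v) = g v.
Proof.
move=> gL ge; have [C [[C0 CD] Cker Csurj]] := kernel_complement.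
have /choice[h hP] v : exists y, C y /\ e y = g v.
  by have [x <-] := ge v; have [y Cy <-] := Csurj x; exists y.
exists h => [c x y|v]; last by case: (hP v).
have [Cx ex] := hP x; have [Cy ey] := hP y; have [Cz ez] := hP (c *: x + y).
apply/eqP; rewrite -subr_eq0; apply/eqP; apply: Cker.
  by rewrite [X in C X]addrC -scaleN1r; apply: (CD) => //; exact: CD.
by rewrite raddfB /= linearP /= ez ex ey gL subrr.
Qed.

End LinearLift.

Section Kernel.
Variables (k : fieldType) (A : algType k) (N Q : bimod A) (f : bihom N Q).

Definition ker_pred : {pred N} := fun x => f x == 0.

Lemma ker_pred_submod : submod_closed ker_pred.
Proof.
split=> [|c x y]; rewrite !unfold_in; first by rewrite raddf0.
by move=> /eqP fx /eqP fy; rewrite linearP /= fx fy scaler0 addr0.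
Qed.

HB.instance Definition _ := GRing.isSubmodClosed.Build k _ ker_pred ker_pred_submod.

Record kernel := Kernel { kernel_val :> N; _ : kernel_val \in ker_pred }.

HB.instance Definition _ := [isSub for kernel_val].
HB.instance Definition _ := [Choice of kernel by <:].
HB.instance Definition _ := [SubChoice_isSubZmodule of kernel by <:].
HB.instance Definition _ := [SubZmodule_isSubLmodule of kernel by <:].

Lemma kernelP (x : kernel) : f (val x) = 0.
Proof. by case: x => x /= /eqP. Qed.

Definition mkkernel x (fx : f x = 0) : kernel := Kernel (introT eqP fx : x \in ker_pred).

Lemma kernel_lact_subproof a (x : kernel) : f (a ⊳ val x) = 0.
Proof. by rewrite bihom_lact kernelP raddf0. Qed.
Lemma kernel_ract_subproof a (x : kernel) : f (val x ⊲ a) = 0.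
Proof. by rewrite bihom_ract kernelP raddf0. Qed.

Program Definition kernel_bimod : bimod A :=
  @Bimod k A kernel (fun a x => mkkernel (kernel_lact_subproof a x))
    (fun a x => mkkernel (kernel_ract_subproof a x)) _ _ _ _ _ _ _ _ _.
Next Obligation. by move=> c a b; apply: val_inj; exact: lact_linearl. Qed.
Next Obligation. by move=> c x y; apply: val_inj; exact: lact_linearr. Qed.
Next Obligation. by move=> c a b; apply: val_inj; exact: ract_linearl. Qed.
Next Obligation. by move=> c x y; apply: val_inj; exact: ract_linearr. Qed.
Next Obligation. by apply: val_inj; exact: lact1. Qed.
Next Obligation. by apply: val_inj; exact: ract1. Qed.
Next Obligation. by apply: val_inj; exact: lactM. Qed.
Next Obligation. by apply: val_inj; exact: ractM. Qed.
Next Obligation. by apply: val_inj; exact: lractA. Qed.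

Variables (P : bimod A) (P_projective : projective_bimod P).

(** Exactness turns [e] into a surjection onto the kernel bimodule of [f], and [g] lands there. *)
Lemma projective_lift (M : bimod A) (e : bihom M N) (g : bihom P N) :
  (forall x, f x = 0 <-> exists y, e y = x) -> (forall p, f (g p) = 0) ->
  exists h : bihom P M, forall p, e (h p) = g p.
Proof.
move=> ex fg.
have fe m : f (e m) = 0 by apply/ex; exists m.
have eP : @is_bihom _ _ M kernel_bimod (fun m => mkkernel (fe m)).
  split=> [c x y|a m|m a]; apply: val_inj => /=; first exact: linearP.
    exact: bihom_lact.
  exact: bihom_ract.
have gP : @is_bihom _ _ P kernel_bimod (fun p => mkkernel (fg p)).
  split=> [c x y|a m|m a]; apply: val_inj => /=; first exact: linearP.
    exact: bihom_lact.
  exact: bihom_ract.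
have [|h hP] := P_projective (p := mkbihom eP) (mkbihom gP).
  by move=> y; have /ex[x xy] := kernelP y; exists x; apply: val_inj.
by exists h => p; have /(congr1 val) := hP p.
Qed.

End Kernel.

Section Coinduced.
Variables (k : fieldType) (A : algType k).

Section Def.
Variable N : bimod A.

Lemma coind_lact_subproof (a : A) (F : klin A N) : linear (fun t => a ⊳ F t).
Proof. by move=> c x y; rewrite !linearP. Qed.
Lemma coind_ract_subproof (b : A) (F : klin A N) : linear (fun t => F (b * t)).
Proof. by move=> c x y; rewrite mulrDr -scalerAr linearP. Qed.

(** Hom_k(A, N) as the right adjoint of forgetting the right action: [N] enters through its left
    action alone. *)
Program Definition coind : bimod A :=
  @Bimod k A (klin A N) (fun a F => mkklin (coind_lact_subproof a F))
    (fun b F => mkklin (coind_ract_subproof b F)) _ _ _ _ _ _ _ _ _.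
Next Obligation. by move=> c a b; apply: klin_ext => t; exact: lact_linearl. Qed.
Next Obligation. by move=> c x y; apply: klin_ext => t; exact: lact_linearr. Qed.
Next Obligation.
by move=> c a b; apply: klin_ext => t /=; rewrite mulrDl -scalerAl linearP.
Qed.
Next Obligation. by move=> c x y; apply: klin_ext. Qed.
Next Obligation. by apply: klin_ext => t; exact: lact1. Qed.
Next Obligation. by apply: klin_ext => t /=; rewrite mul1r. Qed.
Next Obligation. by apply: klin_ext => t; exact: lactM. Qed.
Next Obligation. by apply: klin_ext => t /=; rewrite mulrA. Qed.
Next Obligation. by apply: klin_ext. Qed.

End Def.

Definition left_linear (M N : bimod A) (f : M -> N) : Prop :=
  linear f /\ forall a m, f (a ⊳ m) = a ⊳ f m.

Section Map.
Variables (N Q : bimod A) (f : bihom N Q).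

Lemma coind_map_subproof (F : coind N) : linear (fun t => f ((F : klin A N) t)).
Proof. by move=> c x y; rewrite !linearP. Qed.

Lemma coind_map_bihom :
  @is_bihom _ _ (coind N) (coind Q) (fun F => mkklin (coind_map_subproof F)).
Proof.
split=> [c x y|a F|F a]; apply: klin_ext => t //=; first exact: linearP.
exact: bihom_lact.
Qed.

Definition coind_map : bihom (coind N) (coind Q) := mkbihom coind_map_bihom.

End Map.

Section Adjunction.
Variables (P N : bimod A) (g : P -> N) (gL : left_linear g).

Lemma coind_adj_subproof p : linear (fun t : A => g (p ⊲ t)).
Proof. by move=> c x y; rewrite ract_linearl (proj1 gL). Qed.

Lemma coind_adj_bihom :
  @is_bihom _ _ P (coind N) (fun p => mkklin (coind_adj_subproof p)).
Proof.
split=> [c x y|a p|p a]; apply: klin_ext => t /=.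
- by rewrite linearP (proj1 gL).
- by rewrite -lractA (proj2 gL).
by rewrite ractM.
Qed.

Definition coind_adj : bihom P (coind N) := mkbihom coind_adj_bihom.

End Adjunction.

(* Left linear maps P -> N are the bimodule maps P -> coind N, and coind is exact
   because k is a field. *)
Lemma projective_left_lift (P M N Q : bimod A) (f : bihom N Q) (e : bihom M N)
    (g : P -> N) :
  projective_bimod P -> left_linear g ->
  (forall x, f x = 0 <-> exists y, e y = x) -> (forall p, f (g p) = 0) ->
  exists2 h : P -> M, left_linear h & forall p, e (h p) = g p.
Proof.
move=> Pp gL ex fg.
have [|p|h hP] := @projective_lift _ _ _ _ (coind_map f) _ Pp _ (coind_map e) (coind_adj gL).
- move=> F; split=> [fF|[G <-]]; last first.
    by apply: klin_ext => t /=; apply/ex; exists ((G : klin A M) t).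
  have [c x y|t|G GL GP] := @linear_lift _ _ _ e (fun c x y => linearP e c x y) _ (F : klin A N).
  + exact: linearP.
  + by apply/ex; have := congr1 (fun F : klin A Q => F t) fF.
  by exists (mkklin GL); apply: klin_ext.
- by apply: klin_ext => t /=; exact: fg.
exists (fun p => (h p : klin A M) 1).
  by split=> [c x y|a p]; rewrite ?linearP // bihom_lact.
by move=> p; have := congr1 (fun F : klin A N => F 1) (hP p); rewrite /= ract1.
Qed.

End Coinduced.

Section Contraction.
Variables (k : fieldType) (S : comAlgType k) (P : projective_resolution (regbim S)).

(** As a left module S is free on 1, so any preimage of 1 determines a section; it need not respect
    the right action. *)
Lemma aug_section : exists2 s : S -> P 0, @left_linear _ _ (regbim S) (P 0) s &
  forall t, pr_aug P (s t) = t.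
Proof.
have [x xP] := pr_aug_surj P 1; exists (fun t => t ⊳ x).
  by split=> [c a b|a b]; [exact: lact_linearl | exact: lactM].
by move=> t; rewrite bihom_lact xP /= mulr1.
Qed.

(** The usual contracting homotopy: [x - s (d x)] is killed by [d] thanks to the previous stage, so
    it lifts one term further. Of the homotopy only d s d = d is kept, which is what extending a map
    from the boundaries uses. *)
Lemma resolution_retraction n : exists2 s : P n -> P n.+1, left_linear s &
  forall x, pr_d P n (s (pr_d P n x)) = pr_d P n x.
Proof.
have subL (N Q : bimod S) (d : bihom N Q) (s : Q -> N) : left_linear s ->
    left_linear (fun x => x - s (d x)).
  move=> [sL sl]; split=> [c x y|a m].
    by rewrite linearP sL opprD scalerBr addrACA.
  by rewrite bihom_lact sl lactBr.
elim: n => [|n [s sl sP]].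
  have [s sl sP] := aug_section.
  have [|h hl hP] := projective_left_lift (@pr_projective _ _ _ P 0%N)
      (subL _ _ (pr_aug P) s sl) (@pr_exact0 _ _ _ P).
    by move=> p; rewrite raddfB /= sP subrr.
  exists h => // x; rewrite hP pr_aug_d.
  by have := sP 0; have := proj2 sl 0 0; rewrite !lact0l => -> _; rewrite subr0.
have [|h hl hP] := projective_left_lift (@pr_projective _ _ _ P n.+1)
    (subL _ _ (pr_d P n) s sl) (@pr_exact _ _ _ P n).
  by move=> p; rewrite raddfB /= sP subrr.
exists h => // x; rewrite hP pr_dd.
by have := proj2 sl 0 0; rewrite !lact0l => ->; rewrite subr0.
Qed.

End Contraction.

(** * Enveloping algebras and relative injectivity *)

Section EnvelopeInduction.
Variables (k : fieldType) (S : comAlgType k) (L : lmodType S).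
Variables (LR : lie_rinehart L) (U : envelope LR) (P : U -> Prop).
Hypothesis P_i : forall s, P (env_i U s).
Hypothesis P_j : forall a, P (env_j U a).
Hypothesis P_mul : forall u v, P u -> P v -> P (u * v).
Hypothesis P_lin : forall c u v, P u -> P v -> P (c *: u + v).

Definition env_ind_pred : {pred U} := fun u => `[< P u >].

Lemma env_ind_subalg : subalg_closed env_ind_pred.
Proof.
split=> [|c u v /asboolP Pu /asboolP Pv|u v /asboolP Pu /asboolP Pv]; apply/asboolP.
- by have := P_i 1; rewrite rmorph1.
- exact: P_lin.
exact: P_mul.
Qed.

HB.instance Definition _ :=
  GRing.isSubalgClosed.Build k U env_ind_pred (GRing.subalg_closed_semi env_ind_subalg).

Record env_sub := EnvSub { env_sub_val :> U; _ : env_sub_val \in env_ind_pred }.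

HB.instance Definition _ := [isSub for env_sub_val].
HB.instance Definition _ := [Choice of env_sub by <:].
HB.instance Definition _ := [SubChoice_isSubAlgebra of env_sub by <:].

Definition env_sub_i (s : S) : env_sub := EnvSub (introT (asboolP _) (P_i s)).
Definition env_sub_j (a : L) : env_sub := EnvSub (introT (asboolP _) (P_j a)).

Lemma env_sub_i_additive : zmod_morphism env_sub_i.
Proof. by move=> s t; apply: val_inj; exact: raddfB. Qed.
Lemma env_sub_i_scalable : scalable env_sub_i.
Proof. by move=> c t; apply: val_inj; exact: linearZ. Qed.
Lemma env_sub_i_multiplicative : monoid_morphism env_sub_i.
Proof. by split=> [|s t]; apply: val_inj; [exact: rmorph1 | exact: rmorphM]. Qed.
HB.instance Definition _ := GRing.isZmodMorphism.Build _ _ env_sub_i env_sub_i_additive.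
HB.instance Definition _ := GRing.isScalable.Build _ _ _ _ env_sub_i env_sub_i_scalable.
HB.instance Definition _ := GRing.isMonoidMorphism.Build _ _ env_sub_i env_sub_i_multiplicative.

Lemma env_sub_val_additive : zmod_morphism env_sub_val. Proof. by []. Qed.
Lemma env_sub_val_scalable : scalable env_sub_val. Proof. by []. Qed.
Lemma env_sub_val_multiplicative : monoid_morphism env_sub_val. Proof. by []. Qed.
HB.instance Definition _ := GRing.isZmodMorphism.Build _ _ env_sub_val env_sub_val_additive.
HB.instance Definition _ := GRing.isScalable.Build _ _ _ _ env_sub_val env_sub_val_scalable.
HB.instance Definition _ := GRing.isMonoidMorphism.Build _ _ env_sub_val env_sub_val_multiplicative.

(** The elements satisfying [P] form a subalgebra containing the images of i and j. The universal
    property maps U into it, and uniqueness identifies the composite with the inclusion as the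
    identity of U. *)
Lemma env_ind u : P u.
Proof.
have [jD jb ij ji] := env_pair U.
have pair : enveloping_pair LR env_sub_i env_sub_j.
  by split=> *; apply: val_inj; [exact: jD | exact: jb | exact: ij | exact: ji].
have [h [hi hj _]] := @env_univ _ _ _ _ U _ _ _ pair.
have [h0 [_ _ h0P]] := @env_univ _ _ _ _ U _ _ _ (env_pair U).
have vhi s : env_sub_val (h (env_i U s)) = env_i U s by rewrite hi.
have vhj a : env_sub_val (h (env_j U a)) = env_j U a by rewrite hj.
have -> : u = val (h u).
  transitivity (h0 u); first exact: (h0P idfun).
  by rewrite -(h0P [the {lrmorphism U -> U} of env_sub_val \o h]).
by case: (h u) => v /= /asboolP.
Qed.

End EnvelopeInduction.

(* c is a left S-linear section of the map {malg S[X]} -> U given by b, so that U is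
   projective as a left S-module. *)
Definition left_dual_basis (k : fieldType) (S : comAlgType k) (U : algType k)
    (i : {lrmorphism S -> U}) (X : choiceType) (b : X -> U) (c : U -> {malg S[X]}) : Prop :=
  [/\ zmod_morphism c, forall s u, c (i s * u) = s *: c u
    & forall u, malg_ext (fun x s => i s * b x) (c u) = u].

Section RelativeInjectivity.
Variables (k : fieldType) (S : comAlgType k) (U : algType k).
Variables (i : {lrmorphism S -> U}) (X : choiceType) (b : X -> U) (c : U -> {malg S[X]}).
Hypothesis cP : left_dual_basis i b c.
Variables (I : bimod U) (I_injective : injective_bimod I).

Lemma bihom_id_subproof (M : bimod U) : is_bihom (@idfun M).
Proof. by []. Qed.

(** The map m |-> (u |-> m ⊲ u) is a bimodule map from I to [coind I], injective by evaluation at 1,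
    hence split. Its image is described pointwise, so that the embedding does not have to be
    named. *)
Lemma injective_coind_retract : exists h : bihom (coind I) I,
  forall (F : coind I) m, (forall u, (F : klin U I) u = m ⊲ u) -> h F = m.
Proof.
have uL m : linear (fun u => m ⊲ u : I) by exact: ract_linearl.
have uB : @is_bihom _ _ I (coind I) (fun m => mkklin (uL m)).
  split=> [a x y|a m|m a]; apply: klin_ext => u /=; first exact: linearP.
    by rewrite lractA.
  by rewrite ractM.
have [|h hP] := I_injective (e := mkbihom uB) (mkbihom (bihom_id_subproof I)).
  move=> m n /(congr1 (fun F : klin U I => F 1)) /=.
  by rewrite !ract1.
exists h => F m Fm; rewrite -[RHS](hP m); congr (h _).
by apply: klin_ext => u /=; exact: Fm.
Qed.

Variables (N Q : bimod S) (e : bihom N Q) (f : bihom N (res i I)) (r : Q -> res i I).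
Hypotheses (rL : left_linear r) (re : forall n, r (e n) = f n).

(* As I is a retract of Hom_k(U, I), it suffices to extend f as a map into the latter,
   where f n is the map u |-> f n ⊲ u. *)
Definition rel_inj_fun (q : Q) : U -> I :=
  fun u => malg_ext (fun x s => (r (q ⊲ s) : I) ⊲ b x) (c u).

Let F_additive q x : zmod_morphism (fun s => (r (q ⊲ s) : I) ⊲ b x).
Proof.
move=> s t; rewrite addrC -scaleN1r (ract_linearl q) (proj1 rL) linearP /=.
by rewrite scaleN1r addrC.
Qed.

Lemma rel_inj_fun_linear q : linear (rel_inj_fun q).
Proof.
have [cB cZ _] := cP.
have FB := malg_ext_additive (F_additive q).
move=> a u v; rewrite /rel_inj_fun (zmod_morphismD cB) (zmod_morphismD FB).
have -> : a *: u = i a%:A * u by rewrite linearZ /= rmorph1 mulr_algl.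
rewrite cZ; congr (_ + _); apply: (malg_extZ _ (F_additive q)).
  by move=> x y; rewrite scalerBr.
move=> x s; rewrite mulr_algl; have := ract_linearl q a s 0; rewrite !addr0 => ->.
have := proj1 rL a (q ⊲ s) (q ⊲ 0); rewrite ract0r addr0 => ->.
rewrite linearP /=; have := zmod_morphism0 (F_additive q x).
by rewrite ract0r => ->; rewrite addr0.
Qed.

Lemma rel_inj_bihom :
  @is_bihom _ _ Q (res i (coind I)) (fun q => mkklin (rel_inj_fun_linear q)).
Proof.
have [cB cZ _] := cP.
split=> [a p q|s q|q s]; apply: klin_ext => u /=; rewrite /rel_inj_fun.
- rewrite [RHS](_ : _ = a *: rel_inj_fun p u + rel_inj_fun q u) //.
  rewrite /rel_inj_fun /malg_ext scaler_sumr -big_split; apply: eq_bigr => x _ /=.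
  by rewrite linearP (proj1 rL) linearP.
- rewrite /malg_ext raddf_sum; apply: eq_bigr => x _ /=.
  by rewrite -lractA (proj2 rL) lractA.
(* Right S-linearity comes from the left linearity of [c]; the map [r] is linear on the left
   only. *)
rewrite cZ; apply: esym.
apply: malg_ext_scale => [||x t]; [exact: F_additive | exact: F_additive |].
by rewrite ractM.
Qed.

(** On [e n] the map [r] agrees with [f], whose right S-linearity pulls the coefficients out; the
    expansion of [u] then sums to [f n ⊲ u], which the retraction sends to [f n]. *)
Lemma relative_injective : exists g : bihom Q (res i I), forall n, g (e n) = f n.
Proof.
have [h hP] := injective_coind_retract.
exists (bihom_comp (bihom_res i h) (mkbihom rel_inj_bihom)) => n.
apply: hP => u /=; rewrite /rel_inj_fun.
have [_ _ cK] := cP; rewrite -[in RHS](cK u) /malg_ext.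
have FB : zmod_morphism (fun v : U => (f n : I) ⊲ v).
  by move=> v w; apply: (addIr ((f n : I) ⊲ w)); rewrite -ractDr !subrK.
rewrite (big_morph _ (zmod_morphismD FB) (zmod_morphism0 FB)); apply: eq_bigr => x _.
by rewrite -bihom_ract re bihom_ract /= ractM.
Qed.

End RelativeInjectivity.

(** * The Poincare-Birkhoff-Witt representation *)

Section LieRinehartTheory.
Variables (k : fieldType) (S : comAlgType k) (L : lmodType S) (LR : lie_rinehart L).
Local Notation "[ a , b ]" := (lrbr LR a b).

Lemma lrbrDl a b x : [a + b, x] = [a, x] + [b, x].
Proof. by have := lrbr_linearl LR 1 a b x; rewrite !scale1r. Qed.
Lemma lrbrDr x a b : [x, a + b] = [x, a] + [x, b].
Proof. by have := lrbr_linearr LR 1 x a b; rewrite !scale1r. Qed.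
Lemma lrbrC a b : [a, b] = - [b, a].
Proof.
apply/eqP; rewrite -addr_eq0; have := lrbr_alt LR (a + b).
by rewrite lrbrDl !lrbrDr !lrbr_alt addr0 add0r => ->.
Qed.
Lemma lrbr0r x : [x, 0] = 0.
Proof. by apply: (addrI [x, 0]); rewrite -lrbrDr !addr0. Qed.
Lemma lrbrNr x a : [x, - a] = - [x, a].
Proof. by apply/eqP; rewrite -addr_eq0 -lrbrDr addNr lrbr0r. Qed.
Lemma lrbr_derivation a b c : [[a, b], c] = [a, [b, c]] - [b, [a, c]].
Proof.
rewrite lrbrC; apply/eqP; rewrite eq_sym -addr_eq0; apply/eqP.
by have := lrbr_jacobi LR a b c; rewrite (lrbrC c a) lrbrNr.
Qed.
Lemma lranchorD a b s : lranchor LR (a + b) s = lranchor LR a s + lranchor LR b s.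
Proof. by have := lranchorP LR 1 a b s; rewrite !scale1r. Qed.

End LieRinehartTheory.

Section PBW.
Variables (k : fieldType) (S : comAlgType k) (L : lmodType S) (LR : lie_rinehart L).
Variables (X : choiceType) (le : rel X).
Hypotheses (le_total : total le) (le_trans : transitive le) (le_anti : antisymmetric le).
Variables (e : X -> L) (co : L -> {malg S[X]}).
Hypotheses (co_linear : linear co) (coK : forall a, malg_lin e (co a) = a).
Hypothesis co_e : forall x, co (e x) = << x >>.

Local Notation anc := (lranchor LR).
Local Notation V := {malg S[seq X]}.
Local Notation "[ a , b ]" := (lrbr LR a b).
Local Notation sort := (sort le).

Definition deg_lt n (v : V) : Prop := forall w, (n <= size w)%N -> v@_w = 0.

Lemma deg_ltD n u v : deg_lt n u -> deg_lt n v -> deg_lt n (u + v).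
Proof. by move=> du dv w nw; rewrite mcoeffD du // dv // addr0. Qed.
Lemma deg_ltZ n s v : deg_lt n v -> deg_lt n (s *: v).
Proof. by move=> dv w nw; rewrite mcoeffZ dv // mulr0. Qed.
Lemma deg_lt0 n : deg_lt n 0.
Proof. by move=> w _; rewrite mcoeff0. Qed.
Lemma deg_lt_sum n (I : Type) (r : seq I) (P : pred I) (F : I -> V) :
  (forall i, P i -> deg_lt n (F i)) -> deg_lt n (\sum_(i <- r | P i) F i).
Proof. by move=> FP; apply: (big_ind (deg_lt n)) => //; [exact: deg_lt0 | exact: deg_ltD]. Qed.
Lemma deg_ltW n m v : deg_lt n v -> (n <= m)%N -> deg_lt m v.
Proof. by move=> dv nm w mw; apply: dv; exact: leq_trans mw. Qed.
Lemma deg_ltU n s w : (size w < n)%N -> deg_lt n << s *g w >>.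
Proof.
move=> wn w' nw'; rewrite mcoeffU; case: eqP => // ww'.
by rewrite ww' ltnNge nw' in wn.
Qed.
Lemma deg_lt_size n v w : deg_lt n v -> w \in msupp v -> (size w < n)%N.
Proof. by move=> dv; rewrite -mcoeff_neq0 ltnNge; apply: contraNN => /dv ->. Qed.

Section Action.
Variable T : X -> seq X -> V.

(* An unsorted word is acted on as if it were sorted; this avoids a subtype of sorted
   words. Here and below, locked keeps unification from unfolding sums in {malg _}. *)
Definition act_word : X -> seq X -> V :=
  locked (fun x w => << sort (x :: w) >> + T x (sort w)).

Lemma act_wordE x w : act_word x w = << sort (x :: w) >> + T x (sort w).
Proof. by rewrite /act_word -lock. Qed.

Definition act : X -> V -> V :=
  locked (fun x => malg_ext (fun w s => s *: act_word x w + anc (e x) s *: << w >>)).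

Definition lie_act : L -> V -> V := locked (fun a v => malg_lin (act^~ v) (co a)).

Lemma act_extE x :
  act x = malg_ext (fun w s => s *: act_word x w + anc (e x) s *: << w >>).
Proof. by rewrite /act -lock. Qed.

Lemma actE x v :
  act x v = \sum_(w <- msupp v) (v@_w *: act_word x w + anc (e x) v@_w *: << w >>).
Proof. by rewrite act_extE. Qed.

Lemma lie_act_linE a v : lie_act a v = malg_lin (act^~ v) (co a).
Proof. by rewrite /lie_act -lock. Qed.

Lemma lie_actE a v : lie_act a v = \sum_(x <- msupp (co a)) (co a)@_x *: act x v.
Proof. by rewrite lie_act_linE. Qed.

Let coef_additive x w :
  zmod_morphism (fun s => s *: act_word x w + anc (e x) s *: << w >> : V).
Proof. by move=> s t; rewrite raddfB !scalerBl opprD addrACA. Qed.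

Lemma act_additive x : zmod_morphism (act x).
Proof. rewrite act_extE; exact: malg_ext_additive. Qed.

Lemma actU x w : act x << w >> = act_word x w.
Proof. by rewrite act_extE malg_extU // lranchor1 scale0r addr0 scale1r. Qed.

Lemma actZ x s v : act x (s *: v) = s *: act x v + anc (e x) s *: v.
Proof.
have aB := act_additive x.
move: v; apply: (@malg_ext_eq _ _ _ (fun v => act x (s *: v))
    (fun v => s *: act x v + anc (e x) s *: v)).
- by move=> u v; rewrite scalerBr aB.
- by move=> u v; rewrite aB !scalerBr opprD addrACA.
move=> t w; have H r : act x << r *g w >> = r *: act_word x w + anc (e x) r *: << w >>.
  by rewrite act_extE malg_extU.
have tw : << t *g w >> = t *: << w >> :> V by rewrite malgZU mulr1.
rewrite malgZU !H tw lranchor_leibniz.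
rewrite !scalerDr !scalerDl !scalerA -!addrA.
by apply: (congr2 +%R); [exact: erefl | exact: addrC].
Qed.

Lemma lie_act_additive a : zmod_morphism (lie_act a).
Proof.
move=> u v; rewrite !lie_actE -sumrB.
by apply: eq_bigr => x _; rewrite act_additive scalerBr.
Qed.

Lemma lie_actP s a b v : lie_act (s *: a + b) v = s *: lie_act a v + lie_act b v.
Proof. by rewrite !lie_act_linE co_linear linearP. Qed.

Lemma lie_act_e x v : lie_act (e x) v = act x v.
Proof. by rewrite lie_act_linE co_e malg_linU scale1r. Qed.

Lemma lie_actZ a s v : lie_act a (s *: v) = s *: lie_act a v + anc a s *: v.
Proof.
have ->: anc a s = malg_ext (fun x c => c * anc (e x) s) (co a).
  rewrite -{1}[a]coK; move: (co a); apply: malg_ext_eq.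
  - move=> g h; rewrite linearB -scaleN1r addrC lranchorD lranchorZ mulN1r addrC //.
  - by apply: malg_ext_additive => x c d; rewrite mulrBl.
  move=> c x; rewrite malg_linU lranchorZ malg_extU // => y b d.
  by rewrite mulrBl.
rewrite !lie_actE /malg_ext scaler_sumr scaler_suml -big_split.
by apply: eq_bigr => x _ /=; rewrite actZ scalerDr !scalerA mulrC.
Qed.

Lemma act_deg n x v : (forall w, (size w < n)%N -> deg_lt n.+1 (T x w)) ->
  deg_lt n v -> deg_lt n.+1 (act x v).
Proof.
move=> TP dv; rewrite actE big_seq_cond; apply: deg_lt_sum => w.
rewrite andbT => /(deg_lt_size dv) wn; apply: deg_ltD; last first.
  by apply: deg_ltZ; apply: deg_ltU; exact: ltnW.
apply: deg_ltZ; rewrite act_wordE.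
by apply: deg_ltD; [apply: deg_ltU | apply: TP]; rewrite size_sort.
Qed.

End Action.

(** Locality in the tail: this is why the operators take [T] as a parameter. Partial stages of the
    recursion can be exchanged for its fixed point once the lengths are bounded. *)
Lemma eq_act T T' n x v : (forall w, (size w < n)%N -> T x w = T' x w) ->
  deg_lt n v -> act T x v = act T' x v.
Proof.
move=> TT dv; rewrite !actE; apply: eq_big_seq => w /(deg_lt_size dv) wn.
by rewrite !act_wordE TT // size_sort.
Qed.

Lemma eq_lie_act T T' n a v : (forall x w, (size w < n)%N -> T x w = T' x w) ->
  deg_lt n v -> lie_act T a v = lie_act T' a v.
Proof.
move=> TT dv; rewrite !lie_actE; apply: eq_bigr => x _.
by rewrite (eq_act (T' := T') _ dv) // => w; exact: TT.
Qed.

(* E_x w = sort (x w) + tail x w; for y < x and y w sorted the tail is dictated by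
   E_x E_y w = E_y E_x w + [e_x, e_y] w, as E_y (sort (x w)) = sort (x y w). The
   recursion is on the length of the word, bounded by n. *)
Fixpoint tail_fix n (x : X) (w : seq X) : V :=
  if n isn't m.+1 then 0 else
  if w isn't y :: w' then 0 else
  if le x y then 0 else
  act (tail_fix m) y (tail_fix m x w') + lie_act (tail_fix m) [e x, e y] << w' >>.

Definition tail_rec := locked tail_fix.

Lemma tail_rec0 x w : tail_rec 0 x w = 0.
Proof. by rewrite /tail_rec -lock. Qed.
Lemma tail_rec_nil n x : tail_rec n x [::] = 0.
Proof. by rewrite /tail_rec -lock; case: n. Qed.
Lemma tail_rec_cons n x y w : tail_rec n.+1 x (y :: w) = if le x y then 0 else
  act (tail_rec n) y (tail_rec n x w) + lie_act (tail_rec n) [e x, e y] << w >>.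
Proof. by rewrite /tail_rec -lock. Qed.

(** The tail is shorter than the leading word x w. This keeps the nested operator in the recursion
    on words that the bound n still covers. *)
Lemma tail_rec_deg n x w : deg_lt (size w).+1 (tail_rec n x w).
Proof.
elim: n x w => [|n IHn] x w; first by rewrite tail_rec0; exact: deg_lt0.
case: w => [|y w]; first by rewrite tail_rec_nil; exact: deg_lt0.
rewrite tail_rec_cons; case: ifP => _; first exact: deg_lt0.
have IH z w' : (size w' < size (y :: w))%N -> deg_lt (size (y :: w)).+1 (tail_rec n z w').
  by move=> w'w; apply: (deg_ltW (IHn z w')); rewrite ltnS ltnW.
apply: deg_ltD; first by apply: act_deg; [exact: IH | exact: IHn].
rewrite lie_actE; apply: deg_lt_sum => z _; apply: deg_ltZ.
by apply: act_deg; [exact: IH | exact: deg_ltU].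
Qed.

Lemma tail_rec_stable n m x w :
  (size w <= n)%N -> (size w <= m)%N -> tail_rec n x w = tail_rec m x w.
Proof.
elim: n m x w => [|n IHn] m x w.
  by rewrite leqn0 => /nilP -> _; rewrite !tail_rec_nil.
case: w => [|y w]; first by rewrite !tail_rec_nil.
case: m => [|m]; first by rewrite ltn0.
rewrite -[size (y :: w)]/(size w).+1.
rewrite !ltnS => wn wm.
rewrite (tail_rec_cons n).
rewrite (tail_rec_cons m).
case: (le x y).
  by [].
have IH z w' : (size w' < (size w).+1)%N -> tail_rec n z w' = tail_rec m z w'.
  by rewrite ltnS => w'w; apply: IHn; exact: leq_trans w'w _.
rewrite -(IH x w (ltnSn _)); apply: (congr2 +%R).
  by apply: (@eq_act _ _ (size w).+1); [move=> w'; exact: IH | exact: tail_rec_deg].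
by apply: (eq_lie_act (n := (size w).+1)); [exact: IH | exact: deg_ltU].
Qed.

Definition tail x w := tail_rec (size w) x w.

Lemma tail_cons x y w : tail x (y :: w) = if le x y then 0 else
  act tail y (tail x w) + lie_act tail [e x, e y] << w >>.
Proof.
rewrite -[LHS]/(tail_rec (size w).+1 x (y :: w)) tail_rec_cons.
case: (le x y); first by [].
have IH z w' : (size w' < (size w).+1)%N -> tail_rec (size w) z w' = tail z w'.
  by rewrite ltnS => w'w; apply: tail_rec_stable.
rewrite -(IH x w (ltnSn _)); apply: (congr2 +%R).
  by apply: (@eq_act _ _ (size w).+1); [move=> w'; exact: IH | exact: tail_rec_deg].
by apply: (eq_lie_act (n := (size w).+1)); [exact: IH | exact: deg_ltU].
Qed.

Lemma tail_deg x w : deg_lt (size w).+1 (tail x w).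
Proof. exact: tail_rec_deg. Qed.

Local Notation E := (act tail).
Local Notation A := (lie_act tail).

Lemma sort_perm u v : perm_eq u v -> sort u = sort v.
Proof. by move=> uv; exact/perm_sortP. Qed.

Lemma sort_low y w : all (le y) w -> sort (y :: w) = y :: sort w.
Proof.
move=> yw; apply: (sorted_eq le_trans le_anti).
- exact: sort_sorted.
- by rewrite /= path_sortedE // all_sort yw; exact: sort_sorted.
by rewrite perm_sort perm_cons perm_sym perm_sort.
Qed.

Lemma act_low y w : all (le y) w -> E y << w >> = << sort (y :: w) >>.
Proof.
move=> yw; rewrite actU !act_wordE.
suff -> : tail y (sort w) = 0 by rewrite addr0.
have : all (le y) (sort w) by rewrite all_sort.
case: (sort w) => [_|z u]; first exact: tail_rec_nil.
by rewrite tail_cons /= => /andP[-> _].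
Qed.

Lemma act_sort x w : E x << sort w >> = E x << w >>.
Proof.
rewrite !actU !act_wordE (sort_perm (v := x :: w)); last first.
  by rewrite perm_cons perm_sort.
by rewrite (sort_perm (u := sort w) (v := w)) // perm_sort.
Qed.

Lemma lie_act_sort a w : A a << sort w >> = A a << w >>.
Proof.
by rewrite !lie_actE; apply: eq_bigr => x _; rewrite act_sort.
Qed.

(** The recursion of [tail] read back as a commutation rule: the one case of the bracket relation
    that holds by construction. *)
Lemma act_straighten x y w : all (le y) w -> ~~ le x y ->
  E x (E y << w >>) = E y (E x << w >>) + A [e x, e y] << w >>.
Proof.
move=> yw xy; have yx : le y x by have := le_total x y; rewrite (negPf xy).
have sortC : sort (y :: x :: w) = sort (x :: y :: w).
  by apply: sort_perm; apply/permPl; exact: (perm_catCA [:: y] [:: x] w).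
have yxw : E y << sort (x :: w) >> = << sort (x :: y :: w) >>.
  by rewrite act_sort act_low ?sortC //= yx.
rewrite (act_low yw) act_sort actU act_wordE (sort_low yw) tail_cons (negPf xy).
rewrite [E x << w >>]actU act_wordE (zmod_morphismD (act_additive _ _)) yxw.
by rewrite lie_act_sort addrA.
Qed.

(* The failure of the lemma lie_act_br: it is S-linear in each variable, so that it
   vanishes as soon as it vanishes on words and basis elements. *)
Definition defect a b v := A a (A b v) - A b (A a v) - A [a, b] v.

Lemma defectC a b v : defect b a v = - defect a b v.
Proof.
rewrite /defect (lrbrC LR b a) -[- [a, b]]addr0 -scaleN1r lie_actP scaleN1r.
have -> : A 0 v = 0.
  by have := lie_actP tail 1 0 0 v; rewrite scale1r addr0 scale1r -{1}[A 0 v]addr0 => /addrI.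
by rewrite addr0 !opprB opprK addrC !addrA.
Qed.

Lemma defect_additive a b : zmod_morphism (defect a b).
Proof.
have sub3 (p p' q q' r r' : V) :
    p - p' - (q - q') - (r - r') = p - q - r - (p' - q' - r').
  by rewrite !opprD !opprK !addrA [LHS](ACl (1*3*5*2*4*6)).
by move=> u v; rewrite /defect !lie_act_additive sub3.
Qed.

Lemma lie_act0 v : A 0 v = 0.
Proof.
have := lie_actP tail 1 0 0 v; rewrite !scale1r addr0 => /eqP.
by rewrite -[X in X == _]addr0 (inj_eq (addrI _)) eq_sym => /eqP.
Qed.

Lemma lie_actDl a b v : A (a + b) v = A a v + A b v.
Proof. by have := lie_actP tail 1 a b v; rewrite !scale1r. Qed.

Lemma lie_actZl s a v : A (s *: a) v = s *: A a v.
Proof. by have := lie_actP tail s a 0 v; rewrite addr0 lie_act0 addr0. Qed.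

Lemma lie_actNl a v : A (- a) v = - A a v.
Proof. by rewrite -scaleN1r lie_actZl scaleN1r. Qed.

Lemma lie_actDr a u v : A a (u + v) = A a u + A a v.
Proof. exact: (zmod_morphismD (lie_act_additive _ _)). Qed.

(** The first-order derivation terms occur in both products and cancel; the second-order ones form
    the commutator of the anchors, which is the anchor of the bracket. *)
Lemma defectZ a b s v : defect a b (s *: v) = s *: defect a b v.
Proof.
have cancel (x x' w p q r r' : V) :
    x + p + (q + r) - (x' + q + (p + r')) - (w + (r - r')) = x - x' - w.
  rewrite !opprD !opprK !addrA.
  rewrite [LHS](ACl (1*5*9*(2*7)*(3*6)*(4*10)*(8*11)))/= !subrr addNr.
  by rewrite !addr0.
rewrite /defect !lie_actZ !lie_actDr !lie_actZ lranchor_br scalerBl.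
by rewrite cancel !scalerBr.
Qed.

(** The term by which [A b] differentiates [s] is compensated by the one in [s a, b] = s [a, b] -
    b(s) a. *)
Lemma defectDl s a a' b v : defect (s *: a + a') b v = s *: defect a b v + defect a' b v.
Proof.
have cancel (x x' y y' z z' p : V) :
    x + x' - (y + p + y') - (z - p + z') = x - y - z + (x' - y' - z').
  rewrite !opprD !opprK !addrA.
  rewrite [LHS](ACl (1*3*6*2*5*8*(4*7)))/= addNr.
  by rewrite addr0.
have -> : defect (s *: a + a') b v = s *: A a (A b v) + A a' (A b v) -
    (s *: A b (A a v) + anc b s *: A a v + A b (A a' v)) -
    (s *: A [a, b] v - anc b s *: A a v + A [a', b] v).
  rewrite /defect !lie_actP lie_actDr lie_actZ lrbrDl lie_actDl.
  have -> : [s *: a, b] = s *: [a, b] + (- anc b s) *: a.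
    by rewrite lrbrC lrbrZ (lrbrC LR b a) scalerN opprD opprK scaleNr.
  by rewrite lie_actDl !lie_actZl scaleNr.
by rewrite cancel /defect !scalerBr.
Qed.

Lemma defect0l b v : defect 0 b v = 0.
Proof.
have := defectDl 1 0 0 b v; rewrite !scale1r addr0 => /eqP.
by rewrite -[X in X == _]addr0 (inj_eq (addrI _)) eq_sym => /eqP.
Qed.

Lemma defect_basisl b v : (forall x, defect (e x) b v = 0) -> forall a, defect a b v = 0.
Proof.
move=> H a; rewrite -(coK a); move: (co a).
apply: (@malg_ext_eq _ _ _ (fun g => defect (malg_lin e g) b v) (fun=> 0)).
- move=> g h; rewrite (malg_lin_additive e) addrC -scaleN1r defectDl scaleN1r.
  by rewrite addrC.
- by move=> g h; rewrite subr0.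
move=> c x; rewrite malg_linU -[_ *: _]addr0 defectDl H defect0l scaler0.
by rewrite addr0.
Qed.

Lemma defect0 n a b v :
  (forall x y w, (size w < n)%N -> defect (e x) (e y) << w >> = 0) ->
  deg_lt n v -> defect a b v = 0.
Proof.
move=> H dv; rewrite [v]monalgE.
rewrite (big_morph _ (zmod_morphismD (defect_additive a b))
  (zmod_morphism0 (defect_additive a b))).
rewrite big_seq_cond; apply: big1 => w; rewrite andbT => /(deg_lt_size dv) wn.
rewrite -[v@_w]mulr1 -malgZU defectZ; apply/eqP; rewrite defect_basisl ?scaler0 // => x.
rewrite defectC; apply/eqP; rewrite oppr_eq0; apply/eqP.
by apply: defect_basisl => y; exact: H.
Qed.

(** Induction on length, with x above y by antisymmetry of the defect. If y is below every letter,
    this is [act_straighten]; otherwise the least letter of the word is below both, and the Jacobi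
    identity resolves the overlap. *)
Lemma defect_word n x y w : (size w < n)%N -> defect (e x) (e y) << w >> = 0.
Proof.
elim: n x y w => // n IHn x y w; rewrite ltnS => wn.
have IH a b v : deg_lt n v -> A a (A b v) = A b (A a v) + A [a, b] v.
  by move=> /(defect0 a b IHn)/subr0_eq <-; rewrite addrC subrK.
have [-> | xy] := eqVneq x y.
  by rewrite /defect lrbr_alt lie_act0 subrr subr0.
wlog {xy} xy : x y / ~~ le x y => [wl|].
  have [yx|] := boolP (le x y); last exact: wl.
  rewrite defectC wl ?oppr0 //.
  by apply: contra xy => xy; apply/eqP/le_anti; rewrite yx.
have straight t u z : all (le z) u -> ~~ le t z -> defect (e t) (e z) << u >> = 0.
  move=> zu tz; rewrite /defect !lie_act_e act_straighten //.
  by rewrite [E z _ + _]addrC addrK subrr.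
have -> : defect (e x) (e y) << w >> = defect (e x) (e y) << sort w >>.
  by rewrite /defect !lie_act_sort.
have : (size (sort w) <= n)%N by rewrite size_sort.
have : sorted le (sort w) by exact: sort_sorted.
case: (sort w) => [|z u] /=; first by move=> _ _; exact: straight.
rewrite path_sortedE // => /andP[zu su] un.
have [yz|yz] := boolP (le y z).
  by apply: straight => //=; rewrite yz; apply: sub_all zu => t; exact: le_trans.
have zy : le z y by have := le_total z y; rewrite (negPf yz) orbF.
have xz : ~~ le x z by apply: contra xy => xz; exact: le_trans zy.
have zx : le z x by have := le_total z x; rewrite (negPf xz) orbF.
(* Now z < y < x: move z to the front of E_x E_y E_z u and of E_y E_x E_z u, and compare
   the results by the Jacobi identity. *)
have <- : E z << u >> = << z :: u >>.
  by rewrite act_low // sorted_sort //= path_sortedE // zu.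
have du : deg_lt n (<< u >> : V) by exact: deg_ltU.
pose v : V := << u >>; rewrite -/v in du *.
have IHe s t : E s (E t v) = E t (E s v) + A [e s, e t] v.
  by have := IH (e s) (e t) v du; rewrite !lie_act_e.
(* The leading word of [E t v] may have length n, out of reach of the induction, but z is below all
   its letters, so [straight] applies. The tail is short enough for the induction hypothesis. *)
have swap s t : ~~ le s z -> le z t ->
    E s (E z (E t v)) = E z (E s (E t v)) + A [e s, e z] (E t v).
  move=> sz zt; have : defect (e s) (e z) (E t v) = 0.
    rewrite [E t v]actU !act_wordE (zmod_morphismD (defect_additive (e s) (e z))).
    rewrite (straight _ (sort (t :: u))) //.
      rewrite add0r; apply: (defect0 _ _ IHn).
      by apply: (@deg_ltW (size (sort u)).+1 n); [exact: tail_deg | rewrite size_sort].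
    by rewrite all_sort /= zt.
  by rewrite /defect !lie_act_e => /subr0_eq <-; rewrite addrC subrK.
have actD s := zmod_morphismD (act_additive tail s).
have IHA s a : E s (A a v) = A a (E s v) + A [e s, a] v.
  by have := IH (e s) a v du; rewrite !lie_act_e.
rewrite /defect !lie_act_e (IHe y z) (IHe x z) !actD !swap // !IHA (IHe x y) actD.
have -> : A [e x, e y] (E z v) =
    E z (A [e x, e y] v) + (A [e x, [e y, e z]] v - A [e y, [e x, e z]] v).
  rewrite -lie_actNl -lie_actDl -lrbr_derivation IHA (lrbrC LR (e z)).
  by rewrite lie_actNl subrK.
have cancel (a b p q r r' : V) : a + b + p + (q + r) - (a + q + (p + r')) - (b + (r - r')) = 0.
  rewrite !opprD !opprK !addrA.
  by rewrite [LHS](ACl ((1*6)*(2*10)*(3*8)*(4*7)*(5*11)*(12*9)))/= !subrr !addr0.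
by rewrite cancel.
Qed.

Lemma lie_act_br a b v : A a (A b v) - A b (A a v) = A [a, b] v.
Proof.
apply: subr0_eq; apply: (@defect0 (\max_(w <- msupp v) (size w).+1)).
  by move=> x y w; exact: defect_word.
move=> w wn; apply: mcoeff_outdom; apply: contraTN wn => wv.
by rewrite -ltnNge (leq_bigmax_seq (F := fun w => (size w).+1)).
Qed.

(** * Evaluation of words as ordered products *)

Section Straightening.
Variables (B : algType k) (i : {lrmorphism S -> B}) (j : L -> B).
Hypothesis ijP : enveloping_pair LR i j.

Definition word_prod (w : seq X) : B := \prod_(x <- sort w) j (e x).
Definition eval_words : V -> B := malg_ext (fun w s => i s * word_prod w).

Let coef_additive w : zmod_morphism (fun s => i s * word_prod w).
Proof. by move=> s t; rewrite raddfB mulrBl. Qed.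

Lemma eval_words_additive : zmod_morphism eval_words.
Proof. exact: malg_ext_additive. Qed.

Lemma eval_wordsU w : eval_words << w >> = word_prod w.
Proof. by rewrite /eval_words malg_extU // rmorph1 mul1r. Qed.

Lemma eval_wordsZ s v : eval_words (s *: v) = i s * eval_words v.
Proof.
apply: malg_extZ => //; first by move=> b c; rewrite mulrBr.
by move=> w t; rewrite rmorphM mulrA.
Qed.

Lemma envj0 : j 0 = 0.
Proof.
have [jD _ _ _] := ijP; have := jD 1 0 0; rewrite !scale1r addr0 => /eqP.
by rewrite -[X in X == _]addr0 (inj_eq (addrI _)) eq_sym => /eqP.
Qed.

Definition eval_defect a v : B := eval_words (A a v) - j a * eval_words v.

Lemma eval_defect_additive a : zmod_morphism (eval_defect a).
Proof.
move=> u v; rewrite /eval_defect lie_act_additive !eval_words_additive mulrBr.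
by rewrite !opprD !opprK addrACA.
Qed.

Lemma eval_defectZ a s v : eval_defect a (s *: v) = i s * eval_defect a v.
Proof.
have [_ _ _ ji] := ijP.
rewrite /eval_defect lie_actZ (zmod_morphismD eval_words_additive) !eval_wordsZ mulrBr.
by rewrite -ji mulrBl !mulrA addrA addrAC addrK.
Qed.

Lemma eval_defectDl s a b v :
  eval_defect (s *: a + b) v = i s * eval_defect a v + eval_defect b v.
Proof.
have [jD _ ij _] := ijP.
have jE : j (s *: a + b) = i s * j a + j b.
  by have := jD 1 (s *: a) b; rewrite !scale1r ij.
rewrite /eval_defect jE lie_actP (zmod_morphismD eval_words_additive) eval_wordsZ.
by rewrite mulrDl mulrBr mulrA opprD addrACA.
Qed.

Lemma eval_defect0l v : eval_defect 0 v = 0.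
Proof. by rewrite /eval_defect lie_act0 envj0 mul0r (zmod_morphism0 eval_words_additive) subrr. Qed.

Lemma eval_defect0 n a v :
  (forall x w, (size w < n)%N -> eval_defect (e x) << w >> = 0) ->
  deg_lt n v -> eval_defect a v = 0.
Proof.
move=> H dv; rewrite [v]monalgE.
rewrite (big_morph _ (zmod_morphismD (eval_defect_additive a))
  (zmod_morphism0 (eval_defect_additive a))).
rewrite big_seq_cond; apply: big1 => w; rewrite andbT => /(deg_lt_size dv) wn.
rewrite -[v@_w]mulr1 -malgZU eval_defectZ; apply/eqP.
suff -> : eval_defect a << w >> = 0 by rewrite mulr0.
rewrite -(coK a); move: (co a).
apply: (@malg_ext_eq _ _ _ (fun g => eval_defect (malg_lin e g) << w >>) (fun=> 0)).
- move=> g h; rewrite (malg_lin_additive e) addrC -scaleN1r eval_defectDl rmorphN1 mulN1r.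
  by rewrite addrC.
- by move=> g h; rewrite subr0.
move=> c x; rewrite malg_linU -[_ *: _]addr0 eval_defectDl H // eval_defect0l mulr0.
by rewrite addr0.
Qed.

(** If x precedes the sorted word, both terms are the same ordered product. Otherwise the first
    letter z is below x, and [act_straighten] is matched in [B] by commuting [j (e x)] past
    [j (e z)] at the cost of the bracket. *)
Lemma eval_defect_word n x w : (size w < n)%N -> eval_defect (e x) << w >> = 0.
Proof.
elim: n x w => // n IHn x w; rewrite ltnS => wn.
have IH a v : deg_lt n v -> eval_words (A a v) = j a * eval_words v.
  by move=> /(eval_defect0 a IHn)/subr0_eq.
have low t u : all (le t) u -> eval_words (E t << u >>) = j (e t) * eval_words << u >>.
  move=> tu; rewrite act_low // !eval_wordsU /word_prod (sort_perm (v := t :: u)).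
    by rewrite sort_low // big_cons.
  by rewrite perm_sort.
have -> : eval_defect (e x) << w >> = eval_defect (e x) << sort w >>.
  rewrite /eval_defect lie_act_sort !eval_wordsU /word_prod.
  by rewrite (sort_perm (u := sort w) (v := w)) // perm_sort.
have : (size (sort w) <= n)%N by rewrite size_sort.
have : sorted le (sort w) by exact: sort_sorted.
rewrite /eval_defect lie_act_e.
case: (sort w) => [_ _|z u]; first by rewrite low ?subrr.
rewrite /= path_sortedE // => /andP[zu su] un.
have [xz|xz] := boolP (le x z).
  rewrite low ?subrr //= xz; apply: sub_all zu => t; exact: le_trans.
have zx : le z x by have := le_total z x; rewrite (negPf xz) orbF.
have du : deg_lt n (<< u >> : V) by exact: deg_ltU.
have <- : E z << u >> = << z :: u >>.
  by rewrite act_low // sorted_sort //= path_sortedE // zu.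
have IHe t : eval_words (E t << u >>) = j (e t) * eval_words << u >>.
  by rewrite -lie_act_e IH.
have zxu : eval_words (E z (E x << u >>)) = j (e z) * eval_words (E x << u >>).
  rewrite [E x << u >>]actU !act_wordE (zmod_morphismD (act_additive _ _)).
  rewrite !(zmod_morphismD eval_words_additive) mulrDr low; last first.
    by rewrite all_sort /= zx.
  congr (_ + _); rewrite -lie_act_e IH //.
  by apply: (@deg_ltW (size (sort u)).+1 n); [exact: tail_deg | rewrite size_sort].
have [_ jb _ _] := ijP.
rewrite act_straighten // (zmod_morphismD eval_words_additive) zxu (IH _ _ du) !IHe.
by rewrite jb mulrBl !mulrA (addrCA (_ * _)) subrr addr0 subrr.
Qed.

Lemma eval_words_lie_act a v : eval_words (A a v) = j a * eval_words v.
Proof.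
apply: subr0_eq; apply: (@eval_defect0 (\max_(w <- msupp v) (size w).+1)).
  by move=> x w; exact: eval_defect_word.
move=> w wn; apply: mcoeff_outdom; apply: contraTN wn => wv.
by rewrite -ltnNge (leq_bigmax_seq (F := fun w => (size w).+1)).
Qed.

End Straightening.

End PBW.

(** * From operators on a module to an action of the enveloping algebra *)

Section ScalarRestriction.
Variables (k : fieldType) (S : comAlgType k) (V : lmodType S).

(** A second name for the same group: operators obeying the Leibniz rule are k-linear but not
    S-linear, so they live in End over k. *)
Definition kmod : Type := V.
HB.instance Definition _ := GRing.Zmodule.copy kmod V.

Definition kscale (c : k) (v : kmod) : kmod := c%:A *: (v : V).

Lemma kscaleA c d v : kscale c (kscale d v) = kscale (c * d) v.
Proof. by rewrite /kscale scalerA -scalerAl mul1r scalerA. Qed.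
Lemma kscale1 v : kscale 1 v = v. Proof. by rewrite /kscale !scale1r. Qed.
Lemma kscaleDr c u v : kscale c (u + v) = kscale c u + kscale c v.
Proof. exact: scalerDr. Qed.
Lemma kscaleDl v c d : kscale (c + d) v = kscale c v + kscale d v.
Proof. by rewrite /kscale !scalerDl. Qed.

HB.instance Definition _ := GRing.Zmodule_isLmodule.Build k kmod
  kscaleA kscale1 kscaleDr kscaleDl.

End ScalarRestriction.

Section EndomorphismAlgebra.
Variables (k : fieldType) (V : lmodType k) (v0 : V) (v0_neq0 : v0 != 0).

(* v0 != 0 makes the ring of endomorphisms nontrivial, as algType requires. *)
Definition endo : Type := let _ := v0_neq0 in klin V V.
HB.instance Definition _ := GRing.Lmodule.copy endo (klin V V).

Lemma endo_mul_subproof (f g : klin V V) : linear (f \o g).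
Proof. by move=> c x y /=; rewrite !linearP. Qed.
Lemma endo_one_subproof : linear (idfun : V -> V). Proof. by []. Qed.

Definition endo_mul (f g : endo) : endo := mkklin (endo_mul_subproof f g).
Definition endo_one : endo := mkklin endo_one_subproof.

Lemma endo_mulA : associative endo_mul.
Proof. by move=> f g h; apply: klin_ext. Qed.
Lemma endo_mul1 : left_id endo_one endo_mul.
Proof. by move=> f; apply: klin_ext. Qed.
Lemma endo_mulr1 : right_id endo_one endo_mul.
Proof. by move=> f; apply: klin_ext. Qed.
Lemma endo_mulDl : left_distributive endo_mul +%R.
Proof. by move=> f g h; apply: klin_ext. Qed.
Lemma endo_mulDr : right_distributive endo_mul +%R.
Proof. by move=> f g h; apply: klin_ext => x; exact: (raddfD (f : klin V V)). Qed.
Lemma endo_one_neq0 : endo_one != 0.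
Proof.
apply: contra v0_neq0 => /eqP/(congr1 (fun f : klin V V => f v0)) /= ->.
by [].
Qed.

HB.instance Definition _ := GRing.Zmodule_isNzRing.Build endo
  endo_mulA endo_mul1 endo_mulr1 endo_mulDl endo_mulDr endo_one_neq0.

Lemma endo_scaleAl (c : k) (f g : endo) : c *: (f * g) = c *: f * g.
Proof. exact: klin_ext. Qed.
HB.instance Definition _ := GRing.Lmodule_isLalgebra.Build k endo endo_scaleAl.
Lemma endo_scaleAr (c : k) (f g : endo) : c *: (f * g) = f * (c *: g).
Proof. by apply: klin_ext => x; exact: esym (linearZ_LR (f : klin V V) c (g x)). Qed.
HB.instance Definition _ := GRing.Lalgebra_isAlgebra.Build k endo endo_scaleAr.

End EndomorphismAlgebra.

Section Representation.
Variables (k : fieldType) (S : comAlgType k) (L : lmodType S).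
Variables (LR : lie_rinehart L) (U : envelope LR) (V : lmodType S) (v0 : V) (v0_neq0 : v0 != 0).
Variable op : L -> V -> V.
Hypothesis op_additive : forall a, zmod_morphism (op a).
Hypothesis op_linear : forall s a b v, op (s *: a + b) v = s *: op a v + op b v.
Hypothesis opZ : forall a s v, op a (s *: v) = s *: op a v + lranchor LR a s *: v.
Hypothesis op_br : forall a b v, op (lrbr LR a b) v = op a (op b v) - op b (op a v).

Local Notation W := (kmod V).
Local Notation B := (@endo k W v0 v0_neq0).

Lemma rep_i_subproof (s : S) : linear (fun v : W => s *: (v : V) : W).
Proof.
move=> c u v; rewrite scalerDr; congr (_ + _).
rewrite -[LHS]/(s *: (c%:A *: (u : V))) -[RHS]/(c%:A *: (s *: (u : V))).
by rewrite !scalerA [s * _]mulrC.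
Qed.
Definition rep_i (s : S) : B := mkklin (rep_i_subproof s).

Lemma rep_j_subproof (a : L) : linear (op a : W -> W).
Proof.
move=> c u v; rewrite (zmod_morphismD (op_additive a)); congr (_ + _).
rewrite [LHS](opZ a c%:A u) linearZ /= lranchor1 scaler0 scale0r.
by rewrite addr0.
Qed.
Definition rep_j (a : L) : B := mkklin (rep_j_subproof a).

Lemma rep_i_additive : zmod_morphism rep_i.
Proof.
by move=> s t; apply: klin_ext => v; rewrite -[LHS]/((s - t) *: (v : V)) scalerBl.
Qed.
Lemma rep_i_scalable : scalable rep_i.
Proof.
move=> c s; apply: klin_ext => v; rewrite -[RHS]/(c%:A *: (s *: (v : V))).
by rewrite scalerA mulr_algl.
Qed.
Lemma rep_i_multiplicative : monoid_morphism rep_i.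
Proof.
by split=> [|s t]; apply: klin_ext => v; [exact: (@scale1r S V) | exact: esym (@scalerA S V s t v)].
Qed.
HB.instance Definition _ := GRing.isZmodMorphism.Build _ _ rep_i rep_i_additive.
HB.instance Definition _ := GRing.isScalable.Build _ _ _ _ rep_i rep_i_scalable.
HB.instance Definition _ := GRing.isMonoidMorphism.Build _ _ rep_i rep_i_multiplicative.

Lemma rep_pair : enveloping_pair LR rep_i rep_j.
Proof.
have op0 v : op 0 v = 0.
  have := op_linear 1 0 0 v; rewrite !scale1r addr0 => /eqP.
  by rewrite -[X in X == _]addr0 (inj_eq (addrI _)) eq_sym => /eqP.
split=> [c a b|a b|s a|a s]; apply: klin_ext => v.
- exact: op_linear.
- exact: op_br.
- rewrite -[RHS]/(op (s *: a) v) -[s *: a]addr0 op_linear op0 addr0.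
  by [].
rewrite -[RHS]/(lranchor LR a s *: (v : V)) -[LHS]/(op a (s *: (v : V)) - s *: op a v).
by rewrite opZ addrC addKr.
Qed.

Lemma envelope_representation : exists act : U -> V -> V,
  [/\ forall u, zmod_morphism (act u), forall v, zmod_morphism (act^~ v),
      forall s v, act (env_i U s) v = s *: v, forall a v, act (env_j U a) v = op a v
    & forall u u' v, act (u * u') v = act u (act u' v)].
Proof.
have [h [hi hj _]] := @env_univ _ _ _ _ U _ _ _ rep_pair.
exists (fun u => h u : klin W W); split=> [u|v|s v|a v|u u' v].
- exact: (raddfB (h u : klin W W)).
- by move=> u u'; rewrite raddfB.
- by rewrite hi.
- by rewrite hj.
by rewrite rmorphM.
Qed.

End Representation.

(** Taken from a well-ordering: totality and transitivity come from least elements of lists of two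
    and three elements, antisymmetry from uniqueness of the least element. *)
Lemma total_order_exists (T : eqType) :
  exists le : rel T, [/\ total le, transitive le & antisymmetric le].
Proof.
have [le wo] := well_ordering_principle T.
have min (s : seq T) x : x \in s -> exists2 z, z \in s & {in s, forall y, le z y}.
  move=> xs; have [|z [[zs zP] _]] := wo [in s]; first by exists x.
  by exists z.
have refl x : le x x.
  have [|z] := min [:: x] x; first exact: mem_head.
  by rewrite inE => /eqP -> /(_ _ (mem_head _ _)).
have anti : antisymmetric le.
  move=> x y /andP[xy yx].
  have [|z [_ zP]] := wo [in [:: x; y]]; first by exists x; exact: mem_head.
  rewrite -(zP x); last first.
    by split=> [|t]; rewrite !inE ?eqxx // => /orP[]/eqP->.
  by apply: zP; split=> [|t]; rewrite !inE ?eqxx ?orbT // => /orP[]/eqP->.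
exists le; split=> // [x y|y x z xy yz].
  have [|t] := min [:: x; y] x; first exact: mem_head.
  rewrite !inE => /orP[]/eqP-> tP; apply/orP; [left|right]; apply: tP.
    by rewrite !inE eqxx orbT.
  by rewrite !inE eqxx.
have [|t] := min [:: x; y; z] x; first exact: mem_head.
rewrite !inE => /or3P[]/eqP-> tP; first by apply: tP; rewrite !inE eqxx !orbT.
  by rewrite (anti x y) // xy tP // !inE eqxx.
by rewrite -(anti y z) // yz tP // !inE eqxx orbT.
Qed.

Section FreeCover.
Variables (k : fieldType) (S : comAlgType k) (L M : lmodType S).
Variables (LR : lie_rinehart L) (LRM : lie_rinehart M) (U : envelope LR).
Variables (inj : L -> M) (pr : M -> L).
Hypotheses (inj_linear : linear inj) (pr_linear : linear pr) (injK : cancel inj pr).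
Hypothesis inj_br : forall a b, inj (lrbr LR a b) = lrbr LRM (inj a) (inj b).
Hypothesis inj_anchor : forall a, lranchor LRM (inj a) =1 lranchor LR a.
Hypothesis pr_br : forall a b, pr (lrbr LRM a b) = lrbr LR (pr a) (pr b).
Hypothesis pr_anchor : forall a, lranchor LR (pr a) =1 lranchor LRM a.
Variables (X : choiceType) (e : X -> M) (co : M -> {malg S[X]}).
Hypotheses (co_linear : linear co) (coK : forall a, malg_lin e (co a) = a).
Hypothesis co_e : forall x, co (e x) = << x >>.

(** U acts on the words of [M] along [inj], and words evaluate in U along [pr]. Applying u to the
    empty word and then evaluating gives back u because of [injK]; the first map is the coordinate
    map, the second supplies the generators. *)
Lemma free_cover_left_dual_basis :
  exists (Y : choiceType) (b : Y -> U) (c : U -> {malg S[Y]}),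
    left_dual_basis (env_i U) b c.
Proof.
have [le [le_total le_trans le_anti]] := total_order_exists X.
pose A := lie_act LRM le e co (tail LRM le e co).
pose V := {malg S[seq X]}.
have empty_neq0 : << [::] >> != 0 :> V by rewrite monalgU_eq0 oner_neq0.
have AB a : zmod_morphism (A a) by exact: lie_act_additive.
have AP s a b v : A (s *: a + b) v = s *: A a v + A b v by exact: lie_actP.
have AZ a s v : A a (s *: v) = s *: A a v + lranchor LRM a s *: v.
  exact: (lie_actZ _ _ coK).
have Abr a b v : A (lrbr LRM a b) v = A a (A b v) - A b (A a v).
  exact: esym (lie_act_br _ le_total le_trans le_anti co_linear coK co_e a b v).
have [||||act [actBr actBl acti actj actM]] :=
    @envelope_representation _ _ _ _ U _ _ empty_neq0 (fun a => A (inj a)).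
- by move=> a; exact: AB.
- by move=> s a b v; rewrite inj_linear AP.
- by move=> a s v; rewrite AZ inj_anchor.
- by move=> a b v; rewrite inj_br Abr.
have pr0 : pr 0 = 0.
  have := pr_linear 1 0 0; rewrite !scale1r addr0 => /esym/eqP.
  by rewrite -subr_eq0 addrK => /eqP.
have [jD jb ij ji] := env_pair U.
pose j a := env_j U (pr a).
have ijP : enveloping_pair LRM (env_i U) j.
  split=> [c a b|a b|s a|a s]; rewrite /j.
  - by rewrite pr_linear jD.
  - by rewrite pr_br jb.
  - by rewrite ij -[s *: a]addr0 pr_linear pr0 addr0.
  by rewrite ji pr_anchor.
pose ev := eval_words le e (env_i U) j.
have evB : zmod_morphism ev by exact: eval_words_additive.
have evZ s v : ev (s *: v) = env_i U s * ev v by exact: eval_wordsZ.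
have evA a v : ev (A a v) = j a * ev v.
  exact: (eval_words_lie_act le_total le_trans le_anti co_linear coK co_e ijP).
exists (seq X), (word_prod le e j), (act^~ << [::] >>); split=> [|s u|u].
- exact: actBl.
- by rewrite actM acti.
rewrite -[LHS]/(ev (act u << [::] >>)).
(* Stated for every v, not just the empty word, so that induction passes through products. *)
suff evact v : ev (act u v) = u * ev v.
  by rewrite evact /ev eval_wordsU /word_prod big_nil mulr1.
elim/env_ind: u v => [s|a|u v IHu IHv|c u v IHu IHv] w.
- by rewrite acti evZ.
- by rewrite actj evA /j injK.
- by rewrite actM IHu IHv mulrA.
have -> : c *: u + v = env_i U c%:A * u + v by rewrite linearZ /= rmorph1 mulr_algl.
rewrite (zmod_morphismD (actBl w)) /= (zmod_morphismD evB) actM acti evZ IHu IHv.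
by rewrite mulrDl mulrA.
Qed.

End FreeCover.

(** * Projectivity of the enveloping algebra *)

Section AbelianExtension.
Variables (k : fieldType) (S : comAlgType k) (L : lmodType S) (LR : lie_rinehart L).
Variable X : choiceType.
Local Notation anc := (lranchor LR).
Local Notation F := {malg S[X]}.

(** The flat connection on a free module for which the basis elements are horizontal. *)
Definition coef_anchor (a : L) : F -> F := malg_ext (fun x s => << anc a s *g x >>).

Lemma coef_anchorE a f x : (coef_anchor a f)@_x = anc a f@_x.
Proof.
have FB y : zmod_morphism (fun s => << anc a s *g y >> : F).
  by move=> s t; rewrite !raddfB.
move: f; apply: (@malg_ext_eq _ _ _ (fun f => (coef_anchor a f)@_x) (fun f => anc a f@_x)).
- by move=> f g; rewrite /coef_anchor (malg_ext_additive FB) mcoeffB.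
- by move=> f g; rewrite mcoeffB raddfB.
move=> s y; rewrite /coef_anchor malg_extU // !mcoeffU.
by rewrite raddfMn.
Qed.

Lemma coef_anchorDl s a b f :
  coef_anchor (s *: a + b) f = s *: coef_anchor a f + coef_anchor b f.
Proof.
by apply/malgP => x; rewrite mcoeffD mcoeffZ !coef_anchorE lranchorD lranchorZ.
Qed.

Lemma coef_anchorDr a s f g :
  coef_anchor a (s *: f + g) = s *: coef_anchor a f + anc a s *: f + coef_anchor a g.
Proof.
apply/malgP => x; rewrite !(mcoeffD, mcoeffZ) !coef_anchorE mcoeffD mcoeffZ.
by rewrite raddfD /= lranchor_leibniz [_ + s * _]addrC.
Qed.

Lemma coef_anchorZl s a f : coef_anchor (s *: a) f = s *: coef_anchor a f.
Proof. by apply/malgP => x; rewrite mcoeffZ !coef_anchorE lranchorZ. Qed.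

Lemma coef_anchorZr a s f :
  coef_anchor a (s *: f) = s *: coef_anchor a f + anc a s *: f.
Proof.
apply/malgP => x; rewrite mcoeffD !mcoeffZ !coef_anchorE mcoeffZ lranchor_leibniz.
exact: addrC.
Qed.

Lemma coef_anchor_br a b f : coef_anchor (lrbr LR a b) f =
  coef_anchor a (coef_anchor b f) - coef_anchor b (coef_anchor a f).
Proof. by apply/malgP => x; rewrite mcoeffB !coef_anchorE lranchor_br. Qed.

Lemma coef_anchorB a f g : coef_anchor a (f - g) = coef_anchor a f - coef_anchor a g.
Proof. by apply/malgP => x; rewrite mcoeffB !coef_anchorE mcoeffB raddfB. Qed.

Local Notation M := (L * F)%type.

(* The semidirect product of L with the abelian Lie algebra F, on which L acts through
   its anchor on coefficients. *)
Definition ext_br (u v : M) : M :=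
  (lrbr LR u.1 v.1, coef_anchor u.1 v.2 - coef_anchor v.1 u.2).
Definition ext_anchor (u : M) : S -> S := anc u.1.

Lemma lranchor_alg (a : L) (c : k) : anc a c%:A = 0.
Proof. by rewrite linearZ /= lranchor1 scaler0. Qed.

Program Definition ext_lie_rinehart : lie_rinehart (M : lmodType S) :=
  @LieRinehart k S (M : lmodType S) ext_br ext_anchor _ _ _ _ _ _ _ _ _ _.
Next Obligation.
apply: injective_projections => /=; first exact: lrbr_linearl.
rewrite coef_anchorDl coef_anchorDr lranchor_alg scale0r addr0 scalerBr opprD.
exact: addrACA.
Qed.
Next Obligation.
apply: injective_projections => /=; first exact: lrbr_linearr.
rewrite coef_anchorDl coef_anchorDr lranchor_alg scale0r addr0 scalerBr opprD.
exact: addrACA.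
Qed.
Next Obligation.
by apply: injective_projections; rewrite /= ?lrbr_alt ?subrr.
Qed.
Next Obligation.
have cancel (a b c d f g : F) : a - b - (c - d) + (c - f - (g - b)) + (g - d - (a - f)) = 0.
  rewrite !opprD !opprK !addrA.
  by rewrite [LHS](ACl ((1*11)*(2*8)*(3*5)*(4*10)*(6*12)*(7*9)))/= ?subrr ?addNr !addr0.
apply: injective_projections => /=; first exact: lrbr_jacobi.
rewrite !coef_anchor_br !coef_anchorB; exact: cancel.
Qed.
Next Obligation. exact: lranchor_linear. Qed.
Next Obligation. exact: lranchor_leibniz. Qed.
Next Obligation. exact: lranchorP. Qed.
Next Obligation. exact: lranchor_br. Qed.
Next Obligation. exact: lranchorZ. Qed.
Next Obligation.
apply: injective_projections => /=; first exact: lrbrZ.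
rewrite coef_anchorZl coef_anchorZr scalerBr; exact: addrAC.
Qed.

End AbelianExtension.

(* Eilenberg swindle: if h embeds L as a direct summand of the free module {malg S[L]},
   then L * F is free, where F is the sum of countably many copies of {malg S[L]}; the
   n-th copy is the image of swindle_in n. *)
Section Swindle.
Variables (k : fieldType) (S : comAlgType k) (L : lmodType S) (LR : lie_rinehart L).
Variable h : {linear L -> {malg S[L]}}.
Local Notation X := (L * nat)%type.
Local Notation F := {malg S[X]}.
Local Notation p := (malg_lin (id : L -> L)).
Hypothesis hK : forall a, p (h a) = a.

Definition swindle_in n : {malg S[L]} -> F := malg_lin (fun a => << (a, n) >>).
HB.instance Definition _ n := GRing.Linear.on (swindle_in n).

Lemma swindle_inU n a : swindle_in n << a >> = << (a, n) >>.
Proof. by rewrite /swindle_in malg_linU scale1r. Qed.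

(** Let Q be the kernel of [p], so that {malg S[L]} = Q + h(L) and [<< a >> - h a] is the Q-part of
    [<< a >>]. The sum L + (Q + L) + (Q + L) + ... is regrouped as (L + Q) + (L + Q) + ...: Q-parts
    stay in their copy and L-parts move up by one, which frees copy 0 for the factor L. *)
Definition swindle_shift : F -> F := malg_lin (fun x =>
  swindle_in x.2 (<< x.1 >> - h x.1) + swindle_in x.2.+1 (h x.1)).
HB.instance Definition _ := GRing.Linear.on swindle_shift.

Lemma swindle_shift_in n q :
  swindle_shift (swindle_in n q) = swindle_in n (q - h (p q)) + swindle_in n.+1 (h (p q)).
Proof.
move: q; apply: (@malg_lin_eq _ _ _ (swindle_shift \o swindle_in n)
  ((swindle_in n \o (idfun \- (h \o p))) \+ (swindle_in n.+1 \o (h \o p)))) => x /=.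
by rewrite swindle_inU /swindle_shift !malg_linU !scale1r.
Qed.

Local Notation M := (L * F)%type.

(** The inverse regrouping on basis elements: the L-part moves down by one copy, and from copy 0
    into the factor L itself. *)
Definition swindle_basis (x : X) : M :=
  if x.2 is n.+1 then
    (0, swindle_in n.+1 (<< x.1 >> - h x.1) + swindle_in n (h x.1))
  else (x.1, swindle_in 0 (<< x.1 >> - h x.1)).

Definition swindle_coord (u : M) : F := swindle_in 0 (h u.1) + swindle_shift u.2.

Lemma swindle_coord_linear : linear swindle_coord.
Proof. by move=> c u v; rewrite /swindle_coord !linearP scalerDr addrACA. Qed.

Lemma swindle_coord_basis x : swindle_coord (swindle_basis x) = << x >>.
Proof.
case: x => a n; have ph : p (<< a >> - h a) = 0.
  by rewrite linearB /= hK malg_linU scale1r subrr.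
have in0 m : swindle_in m 0 = 0 by exact: raddf0.
case: n => [|n]; rewrite /swindle_coord /=.
  rewrite swindle_shift_in ph raddf0 subr0 in0 addr0 -raddfD /= addrC subrK.
  exact: swindle_inU.
rewrite raddf0 in0 add0r raddfD /= !swindle_shift_in ph hK raddf0 !subr0 in0 subrr in0.
by rewrite addr0 add0r -raddfD /= subrK swindle_inU.
Qed.

Local Notation lin := (malg_lin (M := M : lmodType S) swindle_basis).

Lemma swindle_basis_in0 q : lin (swindle_in 0 q) = (p q, swindle_in 0 (q - h (p q))).
Proof.
apply: injective_projections; move: q.
  apply: (@malg_lin_eq _ _ _ (fst \o (lin \o swindle_in 0)) p) => x /=.
  by rewrite swindle_inU !malg_linU !scale1r.
apply: (@malg_lin_eq _ _ _ (snd \o (lin \o swindle_in 0))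
  (swindle_in 0 \o (idfun \- (h \o p)))) => x /=.
by rewrite swindle_inU !malg_linU !scale1r.
Qed.

Lemma swindle_basis_inS n q :
  lin (swindle_in n.+1 q) = (0, swindle_in n.+1 (q - h (p q)) + swindle_in n (h (p q))).
Proof.
apply: injective_projections; move: q.
  apply: (@malg_lin_eq _ _ _ (fst \o (lin \o swindle_in n.+1)) \0) => x /=.
  by rewrite swindle_inU !malg_linU !scale1r.
apply: (@malg_lin_eq _ _ _ (snd \o (lin \o swindle_in n.+1))
  ((swindle_in n.+1 \o (idfun \- (h \o p))) \+ (swindle_in n \o (h \o p)))) => x /=.
by rewrite swindle_inU !malg_linU !scale1r.
Qed.

Lemma swindle_coordK u : lin (swindle_coord u) = u.
Proof.
have in0 m : swindle_in m 0 = 0 by exact: raddf0.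
have pair0D (f g : F) : (0, f) + (0, g) = (0, f + g) :> M.
  by apply: injective_projections; rewrite /= ?addr0.
case: u => a f; rewrite /swindle_coord raddfD /= swindle_basis_in0 hK subrr in0.
have -> : lin (swindle_shift f) = (0, f).
  apply: injective_projections; move: f.
    apply: (@malg_lin_eq _ _ _ (fst \o (lin \o swindle_shift)) \0) => x /=.
    rewrite /swindle_shift malg_linU scale1r raddfD; case: x => b [|n] /=.
      rewrite swindle_basis_in0 swindle_basis_inS /=.
      by rewrite raddfB /= hK malg_linU scale1r subrr add0r.
    by rewrite !swindle_basis_inS /= addr0.
  apply: (@malg_lin_eq _ _ _ (snd \o (lin \o swindle_shift)) idfun) => x /=.
  rewrite /swindle_shift malg_linU scale1r raddfD; case: x => b n /=.
  have ph : p (<< b >> - h b) = 0 by rewrite raddfB /= hK malg_linU scale1r subrr.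
  case: n => [|n].
    rewrite swindle_basis_in0 swindle_basis_inS /= ph hK raddf0 subr0 subrr in0 add0r.
    by rewrite -raddfD /= subrK swindle_inU.
  rewrite !swindle_basis_inS /= ph hK raddf0 subr0 subrr !in0 addr0 add0r.
  by rewrite -raddfD /= subrK swindle_inU.
by apply: injective_projections; rewrite /= ?addr0 ?add0r.
Qed.

End Swindle.

Lemma envelope_left_dual_basis (k : fieldType) (S : comAlgType k) (L : lmodType S)
    (LR : lie_rinehart L) (U : envelope LR) : projective_lmod L ->
  exists (X : choiceType) (b : X -> U) (c : U -> {malg S[X]}),
    left_dual_basis (env_i U) b c.
Proof.
move=> L_projective.
have [|h hK] := L_projective {malg S[L]} L (malg_lin (id : L -> L)) idfun.
  by move=> a; exists << a >>; rewrite /= malg_linU scale1r.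
pose M := (L * {malg S[(L * nat)%type]})%type.
have ext0 (f : {malg S[(L * nat)%type]}) : coef_anchor LR 0 f = 0.
  by have := coef_anchorZl LR 0 0 f; rewrite !scale0r.
have ext0r a : coef_anchor LR a (0 : {malg S[(L * nat)%type]}) = 0.
  by have := coef_anchorB LR a 0 (0 : {malg S[(L * nat)%type]}); rewrite !subrr.
apply: (@free_cover_left_dual_basis _ _ _ (M : lmodType S) LR
  (ext_lie_rinehart LR (L * nat)%type) U (fun a => (a, 0)) fst _ _ _ _ _ _ _ _
  (swindle_basis h) (swindle_coord h)).
- by move=> s a b; apply: injective_projections; rewrite /= ?scaler0 ?addr0.
- by [].
- by [].
- by move=> a b; apply: injective_projections => //=; rewrite !ext0r subrr.
- by [].
- by [].
- by [].
- exact: swindle_coord_linear.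
- exact: swindle_coordK.
exact: swindle_coord_basis.
Qed.

(** * Double complexes with exact rows *)

Section CohomologyBijective.
Variables (C D : cochain) (f : cochain_map C D) (n : nat).

Lemma cohomology_map_bijective :
  (forall z : C n, dif z = 0 -> is_coboundary (f n z) -> is_coboundary z) ->
  (forall w : D n, dif w = 0 ->
    exists2 z : C n, dif z = 0 & is_coboundary (w - f n z)) ->
  bijective (@cohomology_map C D f n).
Proof.
move=> finj fsurj.
have cocycleP (E : cochain) (z : cocycle E n) : dif (val z) = 0 by case: z => z /= /eqP.
have mapI : injective (@cohomology_map C D f n).
  move=> x y; have [z <-] := coclass_surj x; have [w <-] := coclass_surj y.
  rewrite !cohomology_mapE => /coclass_eq zw; apply/coclass_eq; apply: finj.
    by rewrite raddfB /= !cocycleP subrr.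
  by rewrite raddfB.
have /choice[g gK] : forall y, exists x, @cohomology_map C D f n x = y.
  move=> y; have [w <-] := coclass_surj y; have [z dz wz] := fsurj _ (cocycleP _ w).
  exists (coclass (Cocycle (introT eqP dz : z \in @cocycle_pred C n))).
  rewrite cohomology_mapE; apply/esym/coclass_eq; exact: wz.
by exists g => // x; apply: mapI; rewrite gK.
Qed.

End CohomologyBijective.

Section DoubleComplex.
Variables (A : nat -> nat -> zmodType).
Variables (D1 : forall p r, A p r -> A p.+1 r) (D2 : forall p r, A p r -> A p r.+1).
Hypotheses (D1_additive : forall p r, zmod_morphism (@D1 p r))
  (D2_additive : forall p r, zmod_morphism (@D2 p r)).
Hypotheses (D1D1 : forall p r x, D1 (@D1 p r x) = 0)
  (D2D2 : forall p r x, D2 (@D2 p r x) = 0)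
  (D2D1 : forall p r x, D2 (@D1 p r x) = - D1 (D2 x)).
Hypothesis D2_exact : forall p r (x : A p r.+1), D2 x = 0 -> exists y, D2 y = x.

Let D1_0 p r : @D1 p r 0 = 0. Proof. exact: (zmod_morphism0 (@D1_additive p r)). Qed.
Let D2_0 p r : @D2 p r 0 = 0. Proof. exact: (zmod_morphism0 (@D2_additive p r)). Qed.
Let D1_D p r : {morph @D1 p r : x y / x + y}.
Proof. exact: (zmod_morphismD (@D1_additive p r)). Qed.
Let D2_D p r : {morph @D2 p r : x y / x + y}.
Proof. exact: (zmod_morphismD (@D2_additive p r)). Qed.

(** No bound on the total degree is imposed, so that primitives can be built column by column. Since
    [D1] and [D2] anticommute, the two directions are interchangeable and the same lemmas serve both
    edges. *)
Definition family := forall p r, A p r.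
Definition family_d1 (h : family) : family := fun p r =>
  if p is p'.+1 then D1 (h p' r) else 0.
Definition family_d2 (h : family) : family := fun p r =>
  if r is r'.+1 then D2 (h p r') else 0.
Definition family_d (h : family) : family := fun p r =>
  family_d1 h p r + family_d2 h p r.

Lemma family_dd h p r : family_d (family_d h) p r = 0.
Proof.
rewrite /family_d /family_d1 /family_d2.
case: p r => [|p] [|r]; rewrite ?addr0 ?add0r //.
- by case: r => [|r]; rewrite ?D2_0 ?D2D2.
- by case: p => [|p]; rewrite ?D1_0 ?D1D1.
rewrite D1_D D2_D D2D1.
have -> : D1 (if p is p'.+1 then D1 (h p' r.+1) else 0) = 0.
  by case: p => [|p]; rewrite ?D1D1 ?D1_0.
have -> : D2 (if r is r'.+1 then D2 (h p.+1 r') else 0) = 0.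
  by case: r => [|r]; rewrite ?D2D2 ?D2_0.
by rewrite add0r addr0 subrr.
Qed.

Lemma family_dB g h p r :
  family_d (fun p r => g p r - h p r) p r = family_d g p r - family_d h p r.
Proof.
rewrite /family_d /family_d1 /family_d2 opprD addrACA.
by case: p r => [|p] [|r]; rewrite ?D1_additive ?D2_additive ?subrr.
Qed.

(** By recursion on p, solve D2 y(p, r) = g(p, r+1) - D1 y(p-1, r+1). The right side is a [D2]-cycle
    by the hypothesis at (p, r+2) and the equation for p - 1. Exactness says nothing at second index
    0, so the edge is left over. *)
Lemma family_fill g : (forall p r, family_d g p r.+2 = 0) ->
  exists y : family, forall p r, g p r.+1 = family_d y p r.+1.
Proof.
move=> dg.
(* The preimage is 0 off the cycles, so that [y] can be defined before its equation is known to be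
   solvable. *)
have sec p r (x : A p r.+1) : exists y, D2 x = 0 -> D2 y = x.
  have [/D2_exact[y yx]|x0] := pselect (D2 x = 0); first by exists y.
  by exists 0.
pose s p r x := projT1 (cid (sec p r x)).
have sP p r x : D2 x = 0 -> D2 (s p r x) = x by exact: projT2 (cid (sec p r x)).
pose y := fix y p : forall r, A p r := match p return forall r, A p r with
  | 0%N => fun r => s 0%N r (g 0%N r.+1)
  | p'.+1 => fun r => s p'.+1 r (g p'.+1 r.+1 - D1 (y p' r.+1)) end.
exists y; elim=> [|p IHp] r; rewrite /family_d /=.
  rewrite add0r sP //; have := dg 0%N r.
  by rewrite /family_d /= add0r.
rewrite sP ?subrKC // D2_additive D2D1 opprK.
have := dg p.+1 r; rewrite /family_d /= (IHp r.+1) addrC.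
rewrite /family_d D1_D.
have -> : D1 (family_d1 y p r.+2) = 0.
  by case: p {IHp} => [|p]; rewrite /= ?D1D1 ?D1_0.
by rewrite add0r.
Qed.

Variables (E : cochain) (aug : forall n, E n -> A n 0).
Hypotheses (aug_additive : forall n, zmod_morphism (@aug n))
  (aug_inj : forall n, injective (@aug n))
  (aug_dif : forall n x, aug (dif x) = D1 (@aug n x))
  (aug_exact : forall n (x : A n 0), D2 x = 0 -> exists e, aug e = x).

Let aug_0 n : @aug n 0 = 0. Proof. exact: (zmod_morphism0 (@aug_additive n)). Qed.

Lemma edge_surjective n h :
  (forall p r, (p + r)%N != n -> h p r = 0) -> (forall p r, family_d h p r = 0) ->
  exists (e : E n) (z : family),
    [/\ dif e = 0, forall p r, (p + r).+1 != n -> z p r = 0,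
        forall p r, h p r.+1 = family_d z p r.+1
      & h n 0%N = aug e + family_d z n 0%N].
Proof.
move=> hn dh; have [y yP] := family_fill (fun p r => dh p r.+2).
(* [family_fill] does not control supports, and a primitive in the total complex must have degree n
   - 1. Truncating is harmless because [h] is homogeneous. *)
pose z : family := fun p r => if (p + r).+1 == n then y p r else 0.
have zP p r : h p r.+1 = family_d z p r.+1.
  have [prn|prn] := eqVneq (p + r).+1 n.
    rewrite yP /family_d /= {2}/z prn eqxx; congr (_ + _).
    by case: p prn {yP} => [|p] //= prn; rewrite /z -prn addSnnS eqxx.
  rewrite hn ?addnS // /family_d /= {2}/z (negPf prn) D2_0.
  rewrite addr0; case: p prn => [|p] //= prn.
  by rewrite /z addnS -addSn (negPf prn) D1_0.
pose c : family := fun p r => h p r - family_d z p r.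
have dc p r : family_d c p r = 0 by rewrite family_dB dh family_dd subrr.
have c0 p r : c p r.+1 = 0 by rewrite /c zP subrr.
have c1 p : family_d1 c p 1%N = 0 by case: p => [|p] //=; rewrite c0 D1_0.
have [|e ec] := aug_exact (x := c n 0%N).
  by have := dc n 1%N; rewrite /family_d c1 add0r.
exists e, z; split=> //.
- apply: aug_inj; rewrite aug_dif ec aug_0.
  by have := dc n.+1 0%N; rewrite /family_d /= addr0.
- by move=> p r prn; rewrite /z (negPf prn).
by rewrite ec subrK.
Qed.

Lemma edge_injective n (e : E n) g :
  (forall p r, family_d g p r.+1 = 0) -> family_d g n 0%N = aug e -> is_coboundary e.
Proof.
move=> dg gn; have [y yP] := family_fill (fun p r => dg p r.+1).
pose c : family := fun p r => g p r - family_d y p r.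
have dc p r : family_d c p r = family_d g p r by rewrite family_dB family_dd subr0.
have c0 p r : c p r.+1 = 0 by rewrite /c yP subrr.
have c1 p : family_d1 c p 1%N = 0 by case: p => [|p] //=; rewrite c0 D1_0.
case: n e gn => [|m] e gn.
  apply: aug_inj; rewrite -gn aug_0.
  by rewrite /family_d /= addr0.
have [|b bc] := aug_exact (x := c m 0%N).
  by have := dc m 1%N; rewrite dg /family_d c1 add0r.
exists b; apply: aug_inj; rewrite aug_dif bc -gn -dc.
by rewrite /family_d /= addr0.
Qed.

End DoubleComplex.

(** * The double complex Hom(P, I) *)

Section HomDoubleComplex.
Variables (k : fieldType) (S : comAlgType k) (L : lmodType S).
Variables (LR : lie_rinehart L) (U : envelope LR) (M : bimod U).
Variables (I : injective_resolution M) (P : projective_resolution (regbim S)).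
Local Notation i := (env_i U).

Definition homPI (p r : nat) : zmodType := bihom (P p) (res i (I r)).
Definition hom_dP p r (f : homPI p r) : homPI p.+1 r := bihom_comp f (pr_d P p).
Definition hom_dI p r (f : homPI p r) : homPI p r.+1 :=
  (bihom_comp (bihom_res i (ir_d I r)) f : homPI p r.+1) *~ (-1) ^+ p.

Lemma mulrz_sign (V : zmodType) (x : V) n : x *~ (-1) ^+ n = if odd n then - x else x.
Proof. by case: (odd n) (signr_odd int n) => <-; rewrite ?expr1 ?mulrNz ?mulr1z. Qed.

Lemma bihom_signE (A : algType k) (N Q : bimod A) (f : bihom N Q) n x :
  (f *~ (-1) ^+ n) x = f x *~ (-1) ^+ n.
Proof. by rewrite !mulrz_sign; case: odd. Qed.

Lemma hom_dP_additive p r : zmod_morphism (@hom_dP p r).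
Proof. by move=> f g; exact: bihom_compBl. Qed.
Lemma hom_dI_additive p r : zmod_morphism (@hom_dI p r).
Proof. by move=> f g; rewrite /hom_dI bihom_compBr mulrzBl. Qed.
Lemma hom_dPdP p r f : hom_dP (@hom_dP p r f) = 0.
Proof. by apply: bihom_ext => x /=; rewrite pr_dd raddf0. Qed.
Lemma hom_dIdI p r f : hom_dI (@hom_dI p r f) = 0.
Proof.
apply: bihom_ext => x; rewrite bihom_signE /= bihom_signE raddfMz /= ir_dd.
by rewrite !mul0rz.
Qed.
Lemma hom_dIdP p r f : hom_dI (@hom_dP p r f) = - hom_dP (hom_dI f).
Proof.
apply: bihom_ext => x; rewrite bihom_signE exprS mulN1r mulrNz.
by rewrite [RHS](_ : _ = - (hom_dI f (pr_d P p x))) // bihom_signE.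
Qed.
Lemma hom_dPdI p r f : hom_dP (@hom_dI p r f) = - hom_dI (hom_dP f).
Proof. by rewrite hom_dIdP opprK. Qed.

Lemma hom_dI_eq0 p r (f : homPI p r) : hom_dI f = 0 -> forall x, ir_d I r (f x) = 0.
Proof.
move=> df x; have := congr1 (fun g : bihom _ _ => g x) df; rewrite bihom_signE.
rewrite mulrz_sign /=; case: odd => // /eqP.
by rewrite oppr_eq0 => /eqP.
Qed.

Lemma hom_dI_exact p r (f : homPI p r.+1) : hom_dI f = 0 -> exists g, hom_dI g = f.
Proof.
move=> /hom_dI_eq0 df.
have [||g gf] := @projective_lift _ _ _ _ (bihom_res i (ir_d I r.+1)) _
    (@pr_projective _ _ _ P p) _ (bihom_res i (ir_d I r)) f.
- by move=> x; exact: ir_exact.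
- exact: df.
exists (g *~ (-1) ^+ p); apply: bihom_ext => x.
rewrite bihom_signE /= bihom_signE -[RHS]gf raddfMz -mulrzA -expr2 sqrr_sign.
exact: mulr1z.
Qed.

Lemma bifam_d_family (h : bifam I P) p r : bifam_d h p r = family_d hom_dP hom_dI h p r.
Proof. by rewrite /bifam_d /family_d; case: p r => [|p] [|r] //=; rewrite mul0rz. Qed.

Lemma bifam_d_family_swap (h : bifam I P) p r : bifam_d h p r =
  family_d (A := fun p r => homPI r p) (fun p r => @hom_dI r p) (fun p r => @hom_dP r p)
    (fun p r => h r p) r p.
Proof. by rewrite bifam_d_family /family_d addrC. Qed.

(** A description uniform in n: for n = 0 the support condition forces z = 0, in agreement with the
    separate clause of [is_coboundary]. *)
Lemma tot_coboundaryP n (x : TotPI I P n) : is_coboundary x <->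
  exists z : bifam I P, (forall p r, (p + r).+1 != n -> z p r = 0) /\
    forall p r, val x p r = bifam_d z p r.
Proof.
have bifam_d0 p r : bifam_d (0 : bifam I P) p r = 0.
  by have := bifam_d_additive (0 : bifam I P) 0; rewrite !subrr => ->.
case: n x => [|n] x; split=> [xE|[z [zn xz]]].
- by exists 0; split=> // p r; rewrite xE bifam_d0.
- apply: tot_ext => p r; rewrite [LHS]xz -[RHS](bifam_d0 p r); congr (bifam_d _ p r).
  by apply: bifam_ext => p' r'; rewrite zn.
- have [y <-] := xE; exists (val y); split=> // p r pr.
  by case: y => y /= /tot_predP; apply; rewrite -eqSS.
have zP : z \in @tot_pred _ _ _ _ _ _ I P n.
  by apply/tot_predP => p r pr; apply: zn; rewrite eqSS.
by exists (Tot zP); apply: tot_ext => p r; rewrite [RHS]xz.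
Qed.

Lemma tot_cocycleP n (x : TotPI I P n) : dif x = 0 -> forall p r, bifam_d (val x) p r = 0.
Proof. by move=> dx p r; rewrite -[LHS]/(val (dif x) p r) dx. Qed.

Lemma tot_support n (x : TotPI I P n) p r : (p + r)%N != n -> val x p r = 0.
Proof. by case: x => x /= /tot_predP; apply. Qed.

Definition coaug_hom n (f : HomPM M P n) : homPI n 0 :=
  bihom_comp (bihom_res i (ir_coaug I)) f.

Lemma coaug_hom_additive n : zmod_morphism (@coaug_hom n).
Proof. by move=> f g; exact: bihom_compBr. Qed.
Lemma coaug_hom_inj n : injective (@coaug_hom n).
Proof.
move=> f g fg; apply: bihom_ext => x; apply: (@ir_coaug_inj _ _ _ I).
exact: (congr1 (fun h : bihom _ _ => h x) fg).
Qed.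
Lemma coaug_hom_dif n (f : HomPM M P n) : coaug_hom (dif f) = hom_dP (coaug_hom f).
Proof. exact: bihom_ext. Qed.
Lemma coaug_hom_exact n (f : homPI n 0) : hom_dI f = 0 -> exists g, coaug_hom g = f.
Proof.
move=> /hom_dI_eq0 df.
have [||g gf] := @projective_lift _ _ _ _ (bihom_res i (ir_d I 0)) _
    (@pr_projective _ _ _ P n) _ (bihom_res i (ir_coaug I)) f.
- by move=> x; exact: ir_exact0.
- exact: df.
by exists g; exact: bihom_ext.
Qed.

Lemma toTotP_val0 n (f : HomPM M P n) : val (toTotP I P n f) n 0%N = coaug_hom f.
Proof. by rewrite /= single_eq (single_eq (T := HomPM M P)). Qed.
Lemma toTotP_valS n (f : HomPM M P n) p r : val (toTotP I P n f) p r.+1 = 0.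
Proof. by rewrite /= single_neq. Qed.

Lemma toTotP_bijective n : bijective (@cohomology_map _ _ (toTotP I P) n).
Proof.
have surj := edge_surjective hom_dP_additive hom_dI_additive hom_dPdP hom_dIdI hom_dIdP
  hom_dI_exact coaug_hom_additive coaug_hom_inj coaug_hom_dif coaug_hom_exact.
have inj := edge_injective hom_dP_additive hom_dI_additive hom_dPdP hom_dIdI hom_dIdP
  hom_dI_exact coaug_hom_additive coaug_hom_inj coaug_hom_dif coaug_hom_exact.
apply: cohomology_map_bijective => [f _ /tot_coboundaryP[g [_ gP]]|h dh].
  apply: (inj _ _ g) => [p r|]; rewrite -bifam_d_family -gP.
    exact: toTotP_valS.
  exact: toTotP_val0.
have [|p r|f [z [df zn hz hz0]]] := surj n (val h).
- exact: tot_support.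
- by rewrite -bifam_d_family tot_cocycleP.
exists f => //; apply/tot_coboundaryP; exists z; split=> // p r.
rewrite [LHS](_ : _ = val h p r - val (toTotP I P n f) p r) // bifam_d_family.
case: r => [|r]; last by rewrite toTotP_valS subr0 hz.
have [->|pn] := eqVneq p n; first by rewrite toTotP_val0 hz0 addrC addKr.
rewrite !tot_support ?addn0 // subrr /family_d /= addr0.
case: p pn => [|p] //= pn; rewrite zn ?addn0 //.
by apply/esym/(zmod_morphism0 (@hom_dP_additive p 0)).
Qed.

End HomDoubleComplex.

(** * Exactness along the projective resolution and the edge from Hom(S, I) *)

Section AugmentedRows.
Variables (k : fieldType) (S : comAlgType k) (L : lmodType S).
Variables (LR : lie_rinehart L) (L_projective : projective_lmod L).
Variables (U : envelope LR) (M : bimod U).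
Variables (I : injective_resolution M) (P : projective_resolution (regbim S)).
Local Notation i := (env_i U).

Definition aug_hom n (f : HomSI I n) : homPI I P 0 n := bihom_comp f (pr_aug P).

Lemma aug_hom_additive n : zmod_morphism (@aug_hom n).
Proof. by move=> f g; exact: bihom_compBl. Qed.
Lemma aug_hom_inj n : injective (@aug_hom n).
Proof.
move=> f g fg; apply: bihom_ext => s; have [x <-] := pr_aug_surj P s.
exact: (congr1 (fun h : bihom _ _ => h x) fg).
Qed.
Lemma aug_hom_dif n (f : HomSI I n) : aug_hom (dif f) = hom_dI (aug_hom f).
Proof. by rewrite /hom_dI mulr1z; apply: bihom_ext. Qed.

Lemma left_linear_comp (N Q R : bimod S) (f : bihom Q R) (s : N -> Q) :
  left_linear s -> left_linear (f \o s).
Proof.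
move=> [sL sl]; split=> [c x y|a m] /=; first by rewrite sL linearP.
by rewrite sl bihom_lact.
Qed.

(** The map [f \o s] extends [f] along the augmentation, since [s (pr_aug P x) - x] is a boundary
    and [f] kills boundaries. It is left linear only; [relative_injective] replaces it by a bimodule
    map. *)
Lemma aug_hom_exact n (f : homPI I P 0 n) : hom_dP f = 0 -> exists g, aug_hom g = f.
Proof.
move=> df; have [X [b [c cP]]] := envelope_left_dual_basis U L_projective.
have [s sl sK] := aug_section P.
have [|x|g gf] := relative_injective cP (@ir_injective _ _ _ I n)
    (e := pr_aug P) (f := f) (r := f \o s).
- exact: left_linear_comp.
- rewrite /=; apply: subr0_eq.
  rewrite -(raddfB (f : bihom (P 0) (res i (I n)))).
  have [|y <-] := (pr_exact0 (p := P) (s (pr_aug P x) - x)).1.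
    by rewrite raddfB /= sK subrr.
  exact: (congr1 (fun h : bihom _ _ => h y) df).
by exists g; exact: bihom_ext.
Qed.

(** The vanishing of the higher Ext over S^e from S to [I r], with the partial homotopy as left
    linear extension. *)
Lemma hom_dP_exact p r (f : homPI I P p.+1 r) : hom_dP f = 0 -> exists g, hom_dP g = f.
Proof.
move=> df; have [X [b [c cP]]] := envelope_left_dual_basis U L_projective.
have [s sl sK] := resolution_retraction P p.
have [|x|g gf] := relative_injective cP (@ir_injective _ _ _ I r)
    (e := pr_d P p) (f := f) (r := f \o s).
- exact: left_linear_comp.
- rewrite /=; apply: subr0_eq.
  rewrite -(raddfB (f : bihom (P p.+1) (res i (I r)))).
  have [|y <-] := (pr_exact (p := P) (s (pr_d P p x) - x)).1.
    by rewrite raddfB /= sK subrr.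
  exact: (congr1 (fun h : bihom _ _ => h y) df).
by exists g; exact: bihom_ext.
Qed.

Lemma toTotI_val0 n (f : HomSI I n) : val (toTotI I P n f) 0%N n = aug_hom f.
Proof. by rewrite /= single_eq (single_eq (T := HomSI I)). Qed.
Lemma toTotI_valS n (f : HomSI I n) p r : val (toTotI I P n f) p.+1 r = 0.
Proof. by rewrite /= single_neq. Qed.

Lemma toTotI_bijective n : bijective (@cohomology_map _ _ (toTotI I P) n).
Proof.
pose dI p r := @hom_dI _ _ _ _ _ _ I P r p.
pose dP p r := @hom_dP _ _ _ _ _ _ I P r p.
have dIB p r : zmod_morphism (@dI p r) by exact: hom_dI_additive.
have dPB p r : zmod_morphism (@dP p r) by exact: hom_dP_additive.
have dII p r f : dI p.+1 r (dI p r f) = 0 by exact: hom_dIdI.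
have dPP p r f : dP p r.+1 (dP p r f) = 0 by exact: hom_dPdP.
have dPI p r f : dP p.+1 r (dI p r f) = - dI p r.+1 (dP p r f) by exact: hom_dPdI.
have dPE p r f : dP p r.+1 f = 0 -> exists g, dP p r g = f by exact: hom_dP_exact.
have surj := edge_surjective (A := fun p r => homPI I P r p) dIB dPB dII dPP dPI dPE
  aug_hom_additive aug_hom_inj aug_hom_dif aug_hom_exact.
have inj := edge_injective (A := fun p r => homPI I P r p) dIB dPB dII dPP dPI dPE
  aug_hom_additive aug_hom_inj aug_hom_dif aug_hom_exact.
apply: cohomology_map_bijective => [f _ /tot_coboundaryP[g [_ gP]]|h dh].
  apply: (inj _ _ (fun p r => g r p)) => [p r|]; rewrite -bifam_d_family_swap -gP.
    exact: toTotI_valS.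
  exact: toTotI_val0.
have [p r pr|p r|f [z [df zn hz hz0]]] := surj n (fun p r => val h r p).
- by rewrite tot_support // addnC.
- by rewrite -bifam_d_family_swap tot_cocycleP.
exists f => //; apply/tot_coboundaryP; exists (fun p r => z r p); split=> [p r pr|p r].
  by rewrite zn // addnC.
rewrite [LHS](_ : _ = val h p r - val (toTotI I P n f) p r) // bifam_d_family_swap.
case: p => [|p]; last by rewrite toTotI_valS subr0 hz.
have [->|rn] := eqVneq r n; first by rewrite toTotI_val0 hz0 addrC addKr.
rewrite !tot_support // subrr /family_d /= addr0.
case: r rn => [|r] //= rn; rewrite zn ?addn0 //.
by apply/esym/(zmod_morphism0 (@hom_dI_additive _ _ _ _ _ _ I P 0 r)).
Qed.

End AugmentedRows.

Lemma cohomology_map_square (C C' D D' : cochain) (f : cochain_map C D)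
    (g : cochain_map C' D') (u : cochain_map C C') (v : cochain_map D D') n x :
  (forall y : C n, g n (u n y) = v n (f n y)) ->
  cohomology_map g (cohomology_map u (x : cohomology C n)) =
  cohomology_map v (cohomology_map f x).
Proof.
move=> guvf; have [z <-] := coclass_surj x; rewrite !cohomology_mapE.
by congr coclass; apply: val_inj; exact: guvf.
Qed.

(** * Transport of the two structures through the total complex *)

Section TotalOperator.
Variables (k : fieldType) (S : comAlgType k) (L : lmodType S).
Variables (LR : lie_rinehart L) (U : envelope LR) (M : bimod U).
Variables (I : injective_resolution M) (P : projective_resolution (regbim S)).

Variable op : forall p r, homPI I P p r -> homPI I P p r.
Hypotheses (op_additive : forall p r, zmod_morphism (@op p r))
  (op_dP : forall p r f, op (@hom_dP _ _ _ _ _ _ I P p r f) = hom_dP (op f))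
  (op_dI : forall p r f, op (@hom_dI _ _ _ _ _ _ I P p r f) = hom_dI (op f)).

Lemma tot_op_subproof n (h : tot I P n) :
  (fun p r => op (val h p r)) \in @tot_pred _ _ _ _ _ _ I P n.
Proof.
apply/tot_predP => p r pr; rewrite tot_support //.
exact: (zmod_morphism0 (@op_additive p r)).
Qed.

Definition tot_op_fun n (h : TotPI I P n) : TotPI I P n := Tot (tot_op_subproof h).

Lemma tot_op_additive n : zmod_morphism (@tot_op_fun n).
Proof. by move=> g h; apply: tot_ext => p r; exact: op_additive. Qed.

Lemma tot_op_dif n (h : TotPI I P n) : tot_op_fun (dif h) = dif (tot_op_fun h).
Proof.
apply: tot_ext => p r; rewrite -[LHS]/(op (bifam_d (val h) p r)).
rewrite -[RHS]/(bifam_d (fun p r => op (val h p r)) p r) !bifam_d_family /family_d.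
rewrite (zmod_morphismD (@op_additive p r)); congr (_ + _).
  case: p => [|p] /=; [exact: (zmod_morphism0 (@op_additive 0 r)) | exact: op_dP].
case: r => [|r] /=; [exact: (zmod_morphism0 (@op_additive p 0)) | exact: op_dI].
Qed.

Definition tot_op : cochain_map (TotPI I P) (TotPI I P) :=
  CochainMap tot_op_fun tot_op_additive tot_op_dif.

Lemma toTotI_op (u : cochain_map (HomSI I) (HomSI I)) :
  (forall n f, aug_hom P (u n f) = op (aug_hom P f)) ->
  forall n f, toTotI I P n (u n f) = tot_op n (toTotI I P n f).
Proof.
move=> uop n f; apply: tot_ext => p r; rewrite -[RHS]/(op (val (toTotI I P n f) p r)).
have op0 p' r' : op (0 : homPI I P p' r') = 0 by exact: (zmod_morphism0 (@op_additive p' r')).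
case: p => [|p]; last by rewrite !toTotI_valS op0.
have [->|rn] := eqVneq r n; first by rewrite !toTotI_val0 uop.
by rewrite !tot_support // op0.
Qed.

Lemma toTotP_op (u : cochain_map (HomPM M P) (HomPM M P)) :
  (forall n f, coaug_hom I (u n f) = op (coaug_hom I f)) ->
  forall n f, toTotP I P n (u n f) = tot_op n (toTotP I P n f).
Proof.
move=> uop n f; apply: tot_ext => p r; rewrite -[RHS]/(op (val (toTotP I P n f) p r)).
have op0 p' r' : op (0 : homPI I P p' r') = 0 by exact: (zmod_morphism0 (@op_additive p' r')).
case: r => [|r]; last by rewrite !toTotP_valS op0.
have [->|pn] := eqVneq p n; first by rewrite !toTotP_val0 uop.
by rewrite !tot_support ?addn0 // op0.
Qed.

End TotalOperator.

Section TransportOperator.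
Variables (k : fieldType) (S : comAlgType k) (L : lmodType S).
Variables (LR : lie_rinehart L) (U : envelope LR) (M : bimod U).
Variables (I : injective_resolution M) (P : projective_resolution (regbim S)).

Lemma toTot_scale (s : S) q (x : cohomology (HomSI I) q) (y : cohomology (HomPM M P) q) :
  cohomology_map (toTotP I P) y = cohomology_map (toTotI I P) x ->
  cohomology_map (toTotP I P) (cohomology_map (HomPM_scale M P s) y) =
  cohomology_map (toTotI I P) (cohomology_map (HomSI_scale I s) x).
Proof.
move=> yx; pose op p r := @hom_scale _ _ _ _ U (P p) (I r) s.
have opB p r : zmod_morphism (@op p r) by exact: hom_scale_additive.
have opdP p r f : @op p.+1 r (hom_dP f) = hom_dP (op p r f) by exact: bihom_ext.
have opdI p r f : @op p r.+1 (hom_dI f) = hom_dI (op p r f).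
  apply: bihom_ext => t; rewrite /= !bihom_signE raddfMz /=.
  by rewrite bihom_lact.
rewrite (cohomology_map_square (f := toTotP I P) (v := tot_op opB opdP opdI)).
  rewrite (cohomology_map_square (f := toTotI I P) (v := tot_op opB opdP opdI)) ?yx //.
  by apply: toTotI_op => n f; exact: bihom_ext.
apply: toTotP_op => n f; apply: bihom_ext => t /=.
exact: bihom_lact.
Qed.

(** Commutation with [toTotI] is [lift_aug]; commutation with [toTotP] is the U-linearity of the
    coaugmentation on both sides. Speaking of two classes with a common image avoids inverting
    either edge map. *)
Lemma toTot_lie (a : L) (D : lifting LR P a) q (x : cohomology (HomSI I) q)
    (y : cohomology (HomPM M P) q) :
  cohomology_map (toTotP I P) y = cohomology_map (toTotI I P) x ->
  cohomology_map (toTotP I P) (cohomology_map (HomPM_lie M D) y) =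
  cohomology_map (toTotI I P) (cohomology_map (HomSI_lie I a) x).
Proof.
move=> yx; pose op p r := @hom_lie _ _ _ _ U (P p) (I r) a _ (lift_anchor D p).
have opB p r : zmod_morphism (@op p r) by exact: hom_lie_additive.
have opdP p r f : @op p.+1 r (hom_dP f) = hom_dP (op p r f).
  by apply: bihom_ext => t /=; rewrite lift_d.
have opdI p r f : @op p r.+1 (hom_dI f) = hom_dI (op p r f).
  have core : op p r.+1 (bihom_comp (bihom_res (env_i U) (ir_d I r)) f) =
      bihom_comp (bihom_res (env_i U) (ir_d I r)) (op p r f) :> homPI I P p r.+1.
    by apply: bihom_ext => t /=; rewrite !raddfB /= bihom_lact bihom_ract.
  rewrite /hom_dI !mulrz_sign; case: odd => //.
  by rewrite (zmod_morphismN (@opB p r.+1)) core.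
rewrite (cohomology_map_square (f := toTotP I P) (v := tot_op opB opdP opdI)).
  rewrite (cohomology_map_square (f := toTotI I P) (v := tot_op opB opdP opdI)) ?yx //.
  by apply: toTotI_op => n f; apply: bihom_ext => t /=; rewrite lift_aug.
apply: toTotP_op => n f; apply: bihom_ext => t /=.
by rewrite !raddfB /= bihom_lact bihom_ract.
Qed.

End TransportOperator.

Theorem theorem2p8 (k : fieldType) (S : comAlgType k) (L : lmodType S)
  (LR : lie_rinehart L) (L_projective : projective_lmod L)
  (U : envelope LR) (M : bimod U)
  (I : injective_resolution M) (P : projective_resolution (regbim S)) (q : nat) :
  [/\ bijective (@cohomology_map _ _ (toTotI I P) q),
      bijective (@cohomology_map _ _ (toTotP I P) q)
    & exists Theta : cohomology (HomSI I) q -> cohomology (HomPM M P) q,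
      [/\ bijective Theta,
          forall x, cohomology_map (toTotP I P) (Theta x) = cohomology_map (toTotI I P) x,
          forall (s : S) x,
            Theta (cohomology_map (HomSI_scale I s) x) =
            cohomology_map (HomPM_scale M P s) (Theta x)
        & forall (a : L) (D : lifting LR P a) x,
            Theta (cohomology_map (HomSI_lie I a) x) =
            cohomology_map (HomPM_lie M D) (Theta x)]].
Proof.
have bijI := toTotI_bijective L_projective I P q.
have bijP := toTotP_bijective I P q.
split=> //; have [invP invPK invKP] := bijP.
exists (fun x => invP (cohomology_map (toTotI I P) x)); split=> [|x|s x|a D x] /=.
- by apply: (@bij_comp _ _ _ invP) => //; exists (@cohomology_map _ _ (toTotP I P) q).
- by rewrite invKP.
- by apply: (bij_inj bijP); rewrite invKP (toTot_scale s (x := x)) // invKP.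
by apply: (bij_inj bijP); rewrite invKP (toTot_lie D (x := x)) // invKP.
Qed.
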